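(* Let $\alpha>0$, let $\Theta\subset\mathbb{R}$, and let $\mathcal{P}=(P_\theta)_{\theta\in\Theta}$ be a statistical model on $\mathcal{X}$ with Lebesgue densities $p_\theta$, differentiable in quadratic mean at $\theta_0\in\overset{\circ}{\Theta}$ with score $s_{\theta_0}$. Suppose the problem $$\mathcal{J}^{\max,\alpha}_{\theta_0}:=\sup_{\mu}\int_{\mathcal{E}} i(r)\,\mu(dr)\quad\text{subject to}\quad \int_{\mathcal{E}} e_x(r)\,\mu(dr)=1\text{ for a.e. }x\in\mathcal{X}$$ (supremum over Radon sub-probability measures $\mu$ on $\mathcal{E}$) admits a maximizer $\bar\mu$ that is symmetric, i.e. $T(\bar\mu)=\bar\mu$. Then there exists $\bar r\in\mathcal{E}$ that maximizes $i^{(s)}$ over $B$, and for such $\bar r$ the two-point measure $$\tilde\mu=\frac{1}{1+e^\alpha}\big(\delta_{\bar r}+\delta_{T(\bar r)}\big)$$ is symmetric, satisfies $\int_{\mathcal{E}} e_x(r)\,\tilde\mu(dr)=1$ for a.e. $x$, and its associated mechanism $q^{(\tilde\mu)}$ has Fisher information $\mathcal{I}_{\theta_0}(q^{(\tilde\mu)}\circ\mathcal{P})=\frac{2}{e^\alpha+1}i^{(s)}(\bar r)=\mathcal{J}^{\max,\alpha}_{\theta_0}$.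
   Context: $\mathcal{X}$ is an open subset of $\mathbb{R}^d$ with Lebesgue measure $dx$. $B=\{v\in L^\infty(\mathcal{X},\mathbb{R}) : 1\le v(x)\le e^\alpha \text{ a.e.}\}$, equipped with the weak-$\star$ topology $\sigma(L^\infty,L^1)$ (which makes $B$ compact and metrizable) and its Borel $\sigma$-algebra $\mathcal{B}(B)$. $\mathcal{E}=\{r\in B : r(x)\in\{1,e^\alpha\}\text{ a.e.}\}$, which is a measurable subset of $B$. $e:\mathcal{X}\times B\to\mathbb{R}$, $(x,r)\mapsto e_x(r)$, is a fixed evaluation operator: it is $\mathcal{B}(\mathcal{X})\otimes\mathcal{B}(B)$-measurable and for every $r\in B$, $e_x(r)=r(x)$ for almost every $x$. $T(r)=e^\alpha+1-r$ for $r\in B$; for a measure $\mu$ on $\mathcal{E}$, $T(\mu)$ is the pushforward of $\mu$ by $T$; $\mu$ is symmetric if $T(\mu)=\mu$. Differentiability in quadratic mean (DQM) at $\theta_0$ means: there is a measurable $s_{\theta_0}$ (the score) with $\int_{\mathcal{X}}\big(\sqrt{p_{\theta_0+h}}-\sqrt{p_{\theta_0}}-\tfrac12 h\,s_{\theta_0}\sqrt{p_{\theta_0}}\big)^2dx=o(h^2)$ as $h\to0$. (Then $\int s_{\theta_0}p_{\theta_0}\,dx=0$ and $\int s_{\theta_0}^2p_{\theta_0}\,dx<\infty$.) For $r\in B$, $$i(r)=\frac{\left(\int_{\mathcal{X}} s_{\theta_0}(x)r(x)p_{\theta_0}(x)\,dx\right)^2}{\int_{\mathcal{X}} r(x)p_{\theta_0}(x)\,dx},\qquad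 i^{(s)}(r)=\tfrac12\big[i(r)+i(T(r))\big].$$ The mechanism associated with a normalized $\mu$ is $q^{(\mu)}(x,dr)=e_x(r)\,\mu(dr)$, and the Fisher information of the privatized model is $\mathcal{I}_{\theta_0}(q^{(\mu)}\circ\mathcal{P})=\int_{\mathcal{E}} i(r)\,\mu(dr)$. *)

(* Defs.v *)
From HB Require Import structures.
From mathcomp Require Import all_boot all_order all_algebra.
From mathcomp Require Import all_classical all_reals all_analysis.
From mathcomp Require Import measurable_realfun ess_sup_inf ring lra.

Set Implicit Arguments.
Unset Strict Implicit.
Unset Printing Implicit Defensive.

Import Order.TTheory GRing.Theory Num.Theory.
Import numFieldNormedType.Exports.

Local Open Scope classical_set_scope.
Local Open Scope ring_scope.

(* Borel sigma-algebra of R^n. *)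
HB.instance Definition _ (R : realType) (n : nat) :=
  Measurable.copy 'rV[R]_n (g_sigma_algebraType (@open 'rV[R]_n)).

Section lebesgue_rV.
Context {R : realType}.

Lemma rV_open_measurable n (U : set 'rV[R]_n) : open U -> measurable U.
Proof. exact: sub_sigma_algebra. Qed.

Lemma rV_measurable_coord n (i : 'I_n) :
  measurable_fun [set: 'rV[R]_n] (fun x : 'rV[R]_n => x ord0 i).
Proof.
apply: (measurability _ (RGenOpens.measurableE R)).
move=> _ [_ [a [b ->]] <-]; rewrite setTI; apply: rV_open_measurable.
apply: open_comp; last exact: interval_open.
by move=> x _; exact: coord_continuous.
Qed.

Let box n (q : 'rV[rat]_n * 'rV[rat]_n) : set 'rV[R]_n :=
  [set x | forall i, ratr (q.1 ord0 i) < x ord0 i < ratr (q.2 ord0 i)].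

Let open_bigcup_box n (U : set 'rV[R]_n) : open U ->
  U = \bigcup_(q in [set q | box q `<=` U]) box q.
Proof.
move=> oU; apply/seteqP; split=> [x Ux|x [q /= qU]]; last exact: qU.
have [P xP PU] : nbhs x U by exact: open_nbhs_nbhs.
have /choice[q qP] (i : 'I_n) : exists q : rat * rat,
    ratr q.1 < x ord0 i < ratr q.2 /\
    forall y : R, ratr q.1 < y < ratr q.2 -> P ord0 i y.
  have /nbhs_ballP[e /= e0 eP] := xP ord0 i.
  have [a /itvP ae] := @rat_in_itvoo R (x ord0 i - e) (x ord0 i)
    ltac:(by rewrite ltrBlDr ltrDl).
  have [b /itvP be] := @rat_in_itvoo R (x ord0 i) (x ord0 i + e)
    ltac:(by rewrite ltrDl).
  exists (a, b); split=> /=; first by rewrite ae be.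
  move=> y /andP[ay yb]; apply: eP; rewrite /ball/= ltr_distlC.
  by rewrite (lt_trans _ ay) ?ae//= (lt_trans yb) ?be.
exists (\row_i (q i).1, \row_i (q i).2); last first.
  by move=> i /=; rewrite !mxE; have [] := qP i.
move=> y /= yq; apply: PU => i j; rewrite (ord1 i).
by have := yq j; rewrite !mxE; have [_] := qP j; apply.
Qed.

Lemma rV_measurable_fun d (T : measurableType d) n (f : T -> 'rV[R]_n) :
  (forall i, measurable_fun [set: T] (fun x => f x ord0 i)) ->
  measurable_fun [set: T] f.
Proof.
move=> mf; apply: (measurability (@open 'rV[R]_n)) => // _ [U oU <-].
rewrite (open_bigcup_box oU) setTI preimage_bigcup bigcup_mkcond.
apply: countable_bigcupT_measurable => // q; case: ifP => // _.
have -> : f @^-1` box q = \bigcap_(i in [set: 'I_n])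
    (fun x => f x ord0 i) @^-1` `]ratr (q.1 ord0 i), ratr (q.2 ord0 i)[.
  by apply/seteqP; split=> [x /= fx i _|x /= fx i];
    [rewrite /= in_itv/= fx|have := fx i Logic.I; rewrite /= in_itv].
apply: fin_bigcap_measurable; first exact: finite_finset.
by move=> i _; rewrite -[X in measurable X]setTI; exact: mf.
Qed.

Definition rV_cons n (x : R * 'rV[R]_n) : 'rV[R]_n.+1 := row_mx (x.1)%:M x.2.

Lemma rV_cons0 n (x : R * 'rV[R]_n) : rV_cons x ord0 ord0 = x.1.
Proof.
have := row_mxEl (x.1)%:M x.2 ord0 ord0; rewrite [RHS]mxE eqxx mulr1n => <-.
by congr (rV_cons x _ _); exact/val_inj.
Qed.

Lemma rV_consS n (x : R * 'rV[R]_n) j :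
  rV_cons x ord0 (lift ord0 j) = x.2 ord0 j.
Proof.
rewrite -(row_mxEr (x.1)%:M x.2 ord0 j).
by congr (rV_cons x _ _); exact/val_inj.
Qed.

Lemma measurable_rV_cons n : measurable_fun [set: R * 'rV[R]_n] (@rV_cons n).
Proof.
apply: rV_measurable_fun => i; case: (unliftP ord0 i) => [j|] ->.
  under eq_fun do rewrite rV_consS.
  exact: (measurableT_comp (rV_measurable_coord j)).
by apply: eq_measurable_fun (@measurable_fst _ _ _ _) => x _; rewrite rV_cons0.
Qed.

Definition rV_uncons n (x : 'rV[R]_n.+1) : R * 'rV[R]_n :=
  (x ord0 ord0, \row_i x ord0 (lift ord0 i)).

Lemma measurable_rV_uncons n : measurable_fun setT (@rV_uncons n).
Proof.
apply/measurable_fun_pairP; split; first exact: rV_measurable_coord.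
apply: rV_measurable_fun => i /=.
under eq_fun do rewrite mxE.
exact: rV_measurable_coord.
Qed.

Lemma rV_consK n : cancel (@rV_cons n) (@rV_uncons n).
Proof.
move=> [a y]; congr pair; first by rewrite rV_cons0.
by apply/rowP => i; rewrite mxE rV_consS.
Qed.

Section lebesgue_rVS.
Variables (n : nat) (m : {sigma_finite_measure set 'rV[R]_n -> \bar R}).

Definition lebesgue_rVS :=
  pushforward (@lebesgue_measure R \x m)%E (@rV_cons n).

HB.instance Definition _ := Measure.copy lebesgue_rVS
  (measure_function_pushforward__canonical__measure_function_Measure
    (@lebesgue_measure R \x m)%E (@measurable_rV_cons n)).

Let lebesgue_rVS_sigma_finite : sigma_finite setT lebesgue_rVS.
Proof.
have /sigma_finiteP[F [FT Fnd mF]] := sigma_finiteT (@lebesgue_measure R).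
have /sigma_finiteP[G [GT Gnd mG]] := sigma_finiteT m.
exists (fun k => @rV_uncons n @^-1` (F k `*` G k)).
  rewrite -preimage_bigcup (_ : \bigcup_k _ = setT)//.
  apply/seteqP; split=> // -[a y] _.
  have [i _ Fia] : (\bigcup_i F i) a by rewrite -FT.
  have [j _ Gjy] : (\bigcup_j G j) y by rewrite -GT.
  exists (maxn i j) => //; split=> /=.
  - by move: Fia; apply: (subsetPset _ _ (Fnd _ _ (leq_maxl i j))).
  - by move: Gjy; apply: (subsetPset _ _ (Gnd _ _ (leq_maxr i j))).
move=> k; have [mFk Fkoo] := mF k; have [mGk Gkoo] := mG k; split.
  rewrite -[X in measurable X]setTI; apply: measurable_rV_uncons => //.
  exact: measurableX.
rewrite /lebesgue_rVS /pushforward -comp_preimage.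
rewrite (_ : @rV_uncons n \o @rV_cons n = id); last first.
  by apply/funext => x /=; rewrite rV_consK.
rewrite preimage_id product_measure1E//.
by rewrite lte_mul_pinfty// ge0_fin_numE.
Qed.

HB.instance Definition _ := @Measure_isSigmaFinite.Build _ _ _ lebesgue_rVS
  lebesgue_rVS_sigma_finite.

End lebesgue_rVS.

(* Lebesgue measure on R^n as an iterated product, R^0 being a point of mass 1;
   [lebesgue_rV_box] gives its value on boxes. *)
Fixpoint lebesgue_rV n : {sigma_finite_measure set 'rV[R]_n -> \bar R} :=
  match n return {sigma_finite_measure set 'rV[R]_n -> \bar R} with
  | 0 => dirac (0 : 'rV[R]_0)
  | n'.+1 => lebesgue_rVS (lebesgue_rV n')
  end.

Lemma lebesgue_rV_box n (a b : 'I_n -> R) : (forall i, a i <= b i) ->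
  lebesgue_rV n [set x : 'rV[R]_n | forall i, a i < x ord0 i <= b i] =
  (\prod_(i < n) (b i - a i))%:E.
Proof.
elim: n a b => [|n IHn] a b ab.
  by rewrite big_ord0 /= diracE mem_set//= => -[].
rewrite big_ord_recl EFinM -IHn; last by move=> i; exact: ab.
rewrite /= /lebesgue_rVS /pushforward.
set A := [set x : 'rV[R]_n | _]; set P := (X in (_ \x _)%E X).
have -> : P = `]a ord0, b ord0] `*` A.
  apply/seteqP; split=> -[x y] /=.
    move=> H; split=> [|i].
      by have := H ord0; rewrite in_itv/= rV_cons0.
    by have := H (lift ord0 i); rewrite rV_consS.
  move=> [H0 H] i; case: (unliftP ord0 i) => [j|] ->.
    by rewrite rV_consS; exact: H.
  by move: H0; rewrite in_itv/= rV_cons0.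
rewrite product_measure1E//; last first.
  rewrite (_ : A = \bigcap_(i in [set: 'I_n]) (fun x : 'rV[R]_n => x ord0 i)
      @^-1` `]a (lift ord0 i), b (lift ord0 i)]).
    apply: fin_bigcap_measurable; first exact: finite_finset.
    move=> i _; rewrite -[X in measurable X]setTI.
    by apply: rV_measurable_coord => //; exact: measurable_itv.
  apply/seteqP; split=> x /= xA i.
    by move=> _; rewrite /= in_itv/=; exact: xA.
  by have := xA i Logic.I; rewrite /= in_itv.
congr (_ * _)%E; have := lebesgue_measure_itv `]a ord0, b ord0].
rewrite /= lte_fin lt_neqAle ab andbT EFinB => ->.
by case: eqVneq => //= ->; rewrite subee.
Qed.

End lebesgue_rV.

Section weak_star.
Context {R : realType} {d : nat} {X : set 'rV[R]_d}.
Variables (oX : open X) (alpha : {posnum R}).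

(* A function on X is represented by a total function on R^d whose values
   outside X are ignored: integrals and a.e. statements are relative to X, and
   L^oo(X) is L^oo of R^d for the restriction of Lebesgue measure to X. *)
Definition lebesgue_on : {measure set 'rV[R]_d -> \bar R} :=
  mrestr (lebesgue_rV d) (rV_open_measurable oX).

Definition Linfty : Type := LspaceType lebesgue_on (leey 1%E).

HB.instance Definition _ := gen_eqMixin Linfty.
HB.instance Definition _ := gen_choiceMixin Linfty.

Definition Linfty_fun (v : Linfty) : 'rV[R]_d -> R := v.
Coercion Linfty_fun : Linfty >-> Funclass.

Lemma measurable_Linfty (v : Linfty) : measurable_fun setT v.
Proof. exact: (@measurable_funPT _ _ _ (measurableTypeR R) (repr _)). Qed.

(* sigma(L^oo, L^1) is the initial topology of v |-> (f |-> \int_X f v), where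
   the right-hand side lives in the product space R^(L^1). *)
Definition weak_star_pairing (v : Linfty) :
    prod_topology (fun _ : LfunType lebesgue_on (lexx 1%E) => R) :=
  fun f => \int[lebesgue_rV d]_(x in X) (f x * v x).

HB.instance Definition _ :=
  Topological.copy Linfty (initial_topology weak_star_pairing).

Definition Bset : set Linfty :=
  [set v | {ae lebesgue_rV d, forall x, X x -> 1 <= v x <= expR alpha%:num}].

Lemma ae_lebesgue_on (P : 'rV[R]_d -> Prop) :
  {ae lebesgue_on, forall x, P x} <->
  {ae lebesgue_rV d, forall x, X x -> P x}.
Proof.
have mX := rV_open_measurable oX.
split=> -[N [mN N0 NP]].
- exists (N `&` X); split=> //; first exact: measurableI.
  by move=> x /= /not_implyP[Xx nPx]; split=> //; exact: NP.
- exists (N `|` ~` X); split.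
  + by apply: measurableU => //; exact: measurableC.
  + apply/eqP; rewrite eq_le measure_ge0 andbT -N0 /= /mrestr setIUl setICl.
    by rewrite setU0 le_measure// inE//; exact: measurableI.
  + move=> x /= nPx; case: (pselect (X x)) => Xx; [left|by right].
    by apply: NP => /= /(_ Xx).
Qed.

(* The element of [Bset] represented by a function with the right bounds. *)
Section class_of.
Variables (f : 'rV[R]_d -> R) (mf : measurable_fun setT f).
Hypothesis fB :
  {ae lebesgue_rV d, forall x, X x -> 1 <= f x <= expR alpha%:num}.

Let g : {mfun 'rV[R]_d >-> measurableTypeR R} :=
  MeasurableFun.Pack (MeasurableFun.Class
    (@isMeasurableFun.Build _ _ 'rV[R]_d (measurableTypeR R) f mf)).

Definition ae_class : {mfun_ lebesgue_on, 'rV[R]_d >-> measurableTypeR R} :=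
  (\pi g)%qT.

Lemma ae_classE : {ae lebesgue_on, forall x, ae_class x = f x}.
Proof.
have /eqP : (\pi_({mfun_ lebesgue_on, 'rV[R]_d >-> measurableTypeR R})
    (repr ae_class) = \pi g)%qT by rewrite reprK.
rewrite eqmodE => /asboolP; apply: filterS => x; exact.
Qed.

Lemma ae_class_bounds :
  {ae lebesgue_rV d, forall x, X x -> 1 <= ae_class x <= expR alpha%:num}.
Proof.
apply/ae_lebesgue_on; move/ae_lebesgue_on : fB; apply: filterS2 ae_classE.
by move=> x ->.
Qed.

Lemma ae_class_finite : finite_norm lebesgue_on +oo%E ae_class.
Proof.
rewrite /finite_norm unlock /Lnorm; case: ifP => // _.
apply: (@le_lt_trans _ _ (expR alpha%:num)%:E); last exact: ltry.
apply/ess_supP; move/ae_lebesgue_on : ae_class_bounds; apply: filterS.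
move=> x /andP[x1 xa] /=; rewrite lee_fin ger0_norm//.
exact: le_trans x1.
Qed.

Definition Linfty_class : Linfty := LebesgueSpace.Pack (LebesgueSpace.Class
  (isFinLebesgue.Build _ _ _ _ _ (leey 1%E) ae_class ae_class_finite)).

Lemma Bset_class : Bset Linfty_class.
Proof. exact: ae_class_bounds. Qed.

End class_of.

Definition Bspace : Type := set_type Bset.

Definition Bspace_val (r : Bspace) : Linfty := \val r.
Coercion Bspace_val : Bspace >-> Linfty.

Lemma Bspace_bounds (r : Bspace) :
  {ae lebesgue_rV d, forall x, X x -> 1 <= r x <= expR alpha%:num}.
Proof. exact: set_valP r. Qed.

Definition Bclass f mf fB : Bspace :=
  exist _ (@Linfty_class f mf fB) (mem_set (@Bset_class f mf fB)).

Lemma expR_alpha_ge1 : 1 <= expR alpha%:num.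
Proof. by rewrite -expR0 ler_expR. Qed.

Let one_bounds :
  {ae lebesgue_rV d, forall x, X x -> 1 <= cst (1 : R) x <= expR alpha%:num}.
Proof. by apply: aeW => x _; rewrite lexx expR_alpha_ge1. Qed.

Definition Bone : Bspace := Bclass (measurable_cst (1 : R)) one_bounds.

(* Subspace topology, and its Borel sigma-algebra; likewise for [Espace]. *)
HB.instance Definition _ := Topological.copy Bspace (set_type Bset).
HB.instance Definition _ := isPointed.Build Bspace Bone.
HB.instance Definition _ :=
  Measurable.copy Bspace (g_sigma_algebraType (@open Bspace)).

Let T_bounds (r : Bspace) : {ae lebesgue_rV d, forall x, X x ->
  1 <= expR alpha%:num + 1 - r x <= expR alpha%:num}.
Proof.
apply: filterS (Bspace_bounds r) => x rx /rx/andP[r1 ra].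
by apply/andP; split; lra.
Qed.

Let measurable_T (r : Bspace) :
  measurable_fun setT (fun x : 'rV[R]_d => expR alpha%:num + 1 - r x).
Proof. exact: measurable_funB (measurable_cst _) (measurable_Linfty r). Qed.

(* T(r) = e^alpha + 1 - r, acting on classes; [TE] is its restriction to E. *)
Definition TB (r : Bspace) : Bspace := Bclass (measurable_T r) (T_bounds r).

Definition Eset : set Bspace := [set r | {ae lebesgue_rV d, forall x, X x ->
  r x = 1 \/ r x = expR alpha%:num}].

Definition Espace : Type := set_type Eset.

Definition Espace_val (r : Espace) : Bspace := \val r.
Coercion Espace_val : Espace >-> Bspace.

Let Eset_Bone : Eset Bone.
Proof.
move/ae_lebesgue_on : (ae_classE (measurable_cst (1 : R))).
by apply: filterS => x H /H; left.
Qed.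

Let Eset_TB (r : Espace) : Eset (TB r).
Proof.
have rE : Eset r := set_valP r.
move/ae_lebesgue_on : (ae_classE (measurable_T r)).
apply: filterS2 rE => x rx H Xx.
rewrite [TB r x]H//; case: (rx Xx) => ->; [right|left]; ring.
Qed.

HB.instance Definition _ := Topological.copy Espace (set_type Eset).
HB.instance Definition _ :=
  isPointed.Build Espace (exist _ Bone (mem_set Eset_Bone)).
HB.instance Definition _ :=
  Measurable.copy Espace (g_sigma_algebraType (@open Espace)).

Definition TE (r : Espace) : Espace := exist _ (TB r) (mem_set (@Eset_TB r)).

End weak_star.

Section models.
Local Open Scope ereal_scope.
Context {R : realType} {dT : measure_display} {T : measurableType dT}.

Definition density_model (nu : {measure set T -> \bar R}) (D : set T)
    (Theta : set R) (p : R -> T -> R) : Prop :=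
  forall theta, Theta theta ->
    [/\ measurable_fun D (p theta),
        forall x, D x -> (0 <= p theta x)%R &
        \int[nu]_(x in D) (p theta x)%:E = 1].

(* The integral is extended-real valued, so a divergent one does not satisfy
   the bound. *)
Definition dqm (nu : {measure set T -> \bar R}) (D : set T)
    (p : R -> T -> R) (theta0 : R) (s : T -> R) : Prop :=
  measurable_fun D s /\
  forall eps : R, (0 < eps)%R -> \forall h \near (0%R : R),
    \int[nu]_(x in D) ((Num.sqrt (p (theta0 + h) x) - Num.sqrt (p theta0 x)
      - 2^-1 * h * s x * Num.sqrt (p theta0 x)) ^+ 2)%R%:E
    <= (eps * h ^+ 2)%R%:E.

(* I is the Fisher information at theta0 of the model (Q theta): for some
   dominating measure the model is DQM at theta0, and I is the second moment of
   the score under Q theta0. This does not depend on the dominating measure. *)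
Definition fisher_information_is (Theta : set R) (Q : R -> set T -> \bar R)
    (theta0 : R) (I : \bar R) : Prop :=
  exists (nu : {sigma_finite_measure set T -> \bar R}) (q : R -> T -> R)
      (t : T -> R),
    [/\ density_model nu setT Theta q,
        forall theta A, Theta theta -> measurable A ->
          Q theta A = \int[nu]_(z in A) (q theta z)%:E,
        dqm nu setT q theta0 t &
        I = \int[nu]_z (t z ^+ 2 * q theta0 z)%R%:E].

End models.

Section problem.
Local Open Scope ereal_scope.
Context {R : realType} {d : nat} {X : set 'rV[R]_d}.
Context {oX : open X} {alpha : {posnum R}}.
Local Notation B := (Bspace oX alpha).
Local Notation E := (Espace oX alpha).
Local Notation leb := (lebesgue_rV d).
Implicit Types (e : 'rV[R]_d -> B -> R) (mu : {measure set E -> \bar R}).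

Definition evaluation_operator e : Prop :=
  measurable_fun (X `*` [set: B]) (fun z => e z.1 z.2) /\
  forall r : B, {ae leb, forall x, X x -> e x r = r x}.

Definition symmetric_measure mu : Prop :=
  forall A : set E, measurable A ->
    pushforward mu (@TE R d X oX alpha) A = mu A.

Definition normalized e mu : Prop :=
  {ae leb, forall x, X x -> \int[mu]_r (e x (Espace_val r))%:E = 1}.

(* Inner regularity; for finite measures nothing else is required. *)
Definition radon mu : Prop :=
  forall A : set E, measurable A ->
    mu A = ereal_sup [set mu K | K in
      [set K : set E | [/\ compact K, measurable K & K `<=` A]]].

Definition feasible e : set (subprobability E R) :=
  [set mu | radon mu /\ normalized e mu].

(* i(r) and i^(s)(r), for the score s and the density p0 at theta0. *)
Definition info (s p0 : 'rV[R]_d -> R) (r : B) : R :=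
  ((\int[leb]_(x in X) (s x * r x * p0 x)) ^+ 2 /
   \int[leb]_(x in X) (r x * p0 x))%R.

Definition info_sym (s p0 : 'rV[R]_d -> R) (r : B) : R :=
  (2^-1 * (info s p0 r + info s p0 (TB r)))%R.

Definition info_integral (s p0 : 'rV[R]_d -> R) mu : \bar R :=
  \int[mu]_r (info s p0 (Espace_val r))%:E.

Definition Jmax e (s p0 : 'rV[R]_d -> R) : \bar R :=
  ereal_sup [set info_integral s p0 mu | mu in feasible e].

Definition mechanism e mu (x : 'rV[R]_d) (A : set E) : \bar R :=
  \int[mu]_(r in A) (e x (Espace_val r))%:E.

Definition privatized (q : 'rV[R]_d -> set E -> \bar R)
    (p : R -> 'rV[R]_d -> R) (theta : R) (A : set E) : \bar R :=
  \int[leb]_(x in X) (q x A * (p theta x)%:E).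

Definition two_point (r : E) : {measure set E -> \bar R} :=
  mscale ((1 + expR alpha%:num)^-1%:nng)%R
    (measure_add (dirac r) (dirac (TE r))).

End problem.

(* Main.v *)
Require Import Defs.
From HB Require Import structures.
From mathcomp Require Import all_boot all_order all_algebra.
From mathcomp Require Import all_classical all_reals all_analysis.
From mathcomp Require Import measurable_realfun ring lra.

Set Implicit Arguments.
Unset Strict Implicit.
Unset Printing Implicit Defensive.

Import Order.TTheory GRing.Theory Num.Theory.
Import numFieldNormedType.Exports.

Local Open Scope classical_set_scope.
Local Open Scope ring_scope.

(** Write [c] for exp(alpha) + 1, [p0] for the density at [theta0], [m(r)] for
the integral of [r * p0], [D(r)] for the integral of [s * r * p0] and [J] for the
optimal value. The score has mean zero ([score_mean0]), so [D(T r) = - D(r)],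
while [m(T r) = c - m(r)]; thus [i^(s)(r)] is half of
[D(r)^2 / m(r) + D(r)^2 / (c - m(r))].

Integrating the normalization against [p0] shows that [m] has integral 1 for
every normalized measure, and a symmetric one must then have total mass [2 / c]
([symmetric_mass]). By symmetry the objective of the given maximizer is also its
integral of [i^(s)]. On the other hand each two-point measure is feasible with
value [2 / c * i^(s)(r)], so that [i^(s)] is at most [c / 2 * J] on E. A measure
of mass [2 / c] can only integrate [i^(s)] to [J] if this bound is reached, which
gives a maximizer over E ([symmetric_optimum]): the existence of an optimal
measure does the work that a compactness argument would otherwise do.

The passage from E to B rests on convexity. The function [D^2 / m] is the
supremum of the linear functions [2 l D - l^2 m], so a point [r] of B has a
linear functional [r' |-> \int g r'] that supports [i^(s)] at [r], up to a
constant; it is maximized over B by the class that is exp(alpha) where [g] is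
positive and 1 elsewhere, which is in E ([info_sym_thresholded]).

For the Fisher information, the privatized laws live on the two points [r] and
[T r], and the density of the law of index theta with respect to the two-point
measure is the integral of [z * p theta] at [z]. Differentiability in quadratic
mean makes [theta |-> p theta] differentiable in L^1 with derivative [s * p0]
([density_increment_small]). The two masses are therefore differentiable, with
derivative [D(z)], and so are their square roots, since the masses are at least
1. This is differentiability in quadratic mean with score [D(z) / m(z)], whose
second moment is the integral of [i] ([two_point_fisher_information]). *)

(** * Classes of functions and the reflection T *)

Lemma ae_eq_integrable d (T : measurableType d) (R : realType)
    (mu : {measure set T -> \bar R}) (D : set T) (f g : T -> \bar R) :
  measurable D -> measurable_fun D g -> ae_eq mu D f g ->
  mu.-integrable D f -> mu.-integrable D g.
Proof.
move=> mD mg fg /integrableP[mf fi]; apply/integrableP; split=> //.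
rewrite -(ae_eq_integral (abse \o g) (abse \o f) mD)//.
- exact: measurableT_comp.
- exact: measurableT_comp.
- by apply: filterS fg => x fgx Dx /=; rewrite fgx.
Qed.

Section classes.
Context {R : realType} {d : nat} {X : set 'rV[R]_d}.
Context {oX : open X} {alpha : {posnum R}}.
Local Notation B := (Bspace oX alpha).
Local Notation E := (Espace oX alpha).
Local Notation leb := (lebesgue_rV d).
Local Notation a := (expR alpha%:num).

Let mX : measurable X := rV_open_measurable oX.

(** Equality of classes is Leibniz equality: the representatives agree modulo the
quotient, and the finiteness of the norm is a proof-irrelevant proposition. *)
Lemma Linfty_ae_eq (v w : Linfty oX) :
  {ae leb, forall x, X x -> v x = w x} -> v = w.
Proof.
move=> /(ae_lebesgue_on oX) vw.
case: v w vw => [v [[vP]]] [w [[wP]]] /= vw.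
have vwE : v = w.
  apply/eqP; rewrite -[v]reprK -[w]reprK eqmodE; apply/asboolP.
  by apply: filterS vw => x vwx _; exact: vwx.
by subst w; congr (LebesgueSpace.Pack (LebesgueSpace.Class _));
  congr isFinLebesgue.Axioms_; exact: Prop_irrelevance.
Qed.

Lemma Bspace_ae_eq (r r' : B) :
  {ae leb, forall x, X x -> r x = r' x} -> r = r'.
Proof. by move=> /Linfty_ae_eq rr'; exact: val_inj. Qed.

Lemma BclassE (f : 'rV[R]_d -> R) (mf : measurable_fun setT f) fB :
  {ae leb, forall x, X x -> (@Bclass _ _ _ oX alpha f mf fB : B) x = f x}.
Proof. by move/ae_lebesgue_on : (ae_classE oX mf). Qed.

Lemma TBE (r : B) : {ae leb, forall x, X x -> TB r x = a + 1 - r x}.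
Proof. exact: BclassE. Qed.

Lemma TBK : involutive (@TB _ _ _ oX alpha).
Proof.
move=> r; apply: Bspace_ae_eq.
apply: filterS2 (TBE r) (TBE (TB r)) => x rx Trx Xx.
by rewrite Trx// rx//; ring.
Qed.

Lemma TEK : involutive (@TE _ _ _ oX alpha).
Proof. by move=> r; apply: val_inj; exact: TBK. Qed.

(** A representative of the class [r] that has its bounds at every point and not
only almost everywhere, so that integrands can be compared pointwise. *)
Definition clip (r : B) (x : 'rV[R]_d) : R := Num.max 1 (Num.min a (r x)).

Lemma measurable_Bspace (r : B) D : measurable_fun D r.
Proof. exact: measurable_funTS (measurable_Linfty r). Qed.

Lemma measurable_clip (r : B) D : measurable_fun D (clip r).
Proof.
apply: measurable_maxr; first exact: measurable_cst.
by apply: measurable_minr; [exact: measurable_cst|exact: measurable_Bspace].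
Qed.

Lemma clip_bounds (r : B) x : 1 <= clip r x <= a.
Proof.
rewrite /clip le_max lexx /= ge_max expR_alpha_ge1 /=.
by rewrite ge_min lexx.
Qed.

Lemma clipE (r : B) : {ae leb, forall x, X x -> clip r x = r x}.
Proof.
apply: filterS (Bspace_bounds r) => x rx /rx/andP[r1 ra].
by rewrite /clip (min_idPr ra) (max_idPr r1).
Qed.

Lemma integrable_clip (f : 'rV[R]_d -> R) (r : B) :
  leb.-integrable X (EFin \o f) ->
  leb.-integrable X (EFin \o (fun x => f x * clip r x)).
Proof.
move=> fi; have mf := measurable_int _ fi.
apply: (@le_integrable _ _ _ _ _ mX _ (fun x => a%:E * (EFin \o f) x)%E).
- apply/measurable_EFinP/measurable_funM; first exact/measurable_EFinP.
  exact: measurable_clip.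
- move=> x Xx /=; rewrite lee_fin normrM [leRHS]normrM mulrC.
  have /andP[c1 ca] := clip_bounds r x.
  rewrite ler_wpM2r// !ger0_norm ?expR_ge0//.
  exact: le_trans c1.
- exact: integrableZl.
Qed.

Lemma integrable_mulB (f : 'rV[R]_d -> R) (r : B) :
  leb.-integrable X (EFin \o f) ->
  leb.-integrable X (EFin \o (fun x => f x * r x)).
Proof.
move=> fi; have mf := measurable_int _ fi.
apply: ae_eq_integrable (integrable_clip r fi) => //.
- apply/measurable_EFinP/measurable_funM; first exact/measurable_EFinP.
  exact: measurable_Bspace.
- by apply: filterS (clipE r) => x rx Xx /=; rewrite rx.
Qed.

Lemma Rintegral_clip (f : 'rV[R]_d -> R) (r : B) :
  leb.-integrable X (EFin \o f) ->
  \int[leb]_(x in X) (f x * r x) = \int[leb]_(x in X) (f x * clip r x).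
Proof.
move=> fi; congr fine; apply: ae_eq_integral => //.
- exact: measurable_int (integrable_mulB r fi).
- exact: measurable_int (integrable_clip r fi).
- by apply: filterS (clipE r) => x rx Xx /=; rewrite rx.
Qed.

Lemma Rintegral_TB (f : 'rV[R]_d -> R) (r : B) :
  leb.-integrable X (EFin \o f) ->
  \int[leb]_(x in X) (f x * TB r x) =
  (a + 1) * \int[leb]_(x in X) f x - \int[leb]_(x in X) (f x * r x).
Proof.
move=> fi; rewrite -RintegralZl// -RintegralB//; last 2 first.
- by apply: eq_integrable (integrableZl mX (a + 1) fi).
- exact: integrable_mulB.
congr fine; apply: ae_eq_integral => //.
- exact: measurable_int (integrable_mulB (TB r) fi).
- apply/measurable_EFinP/measurable_funB.
    apply: measurable_funM; first exact: measurable_cst.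
    by apply/measurable_EFinP; exact: measurable_int fi.
  by apply/measurable_EFinP; exact: measurable_int (integrable_mulB r fi).
- by apply: filterS (TBE r) => x rx Xx /=; rewrite rx// mulrBr mulrC.
Qed.

End classes.

(** * The weak-star topology *)

Section product.
Context {I : Type} {K : I -> topologicalType}.

Lemma prod_eval_continuous (i : I) : continuous (fun w : prod_topology K => w i).
Proof.
move=> w.
have /cvg_sup/(_ i) h : nbhs w --> w by exact: cvg_id.
apply: cvg_trans (@initial_continuous _ (K i) (fun w : prod_topology K => w i) w).
exact: cvg_app h.
Qed.

Lemma continuous_prod (S : topologicalType) (f : S -> prod_topology K) :
  (forall i, continuous (fun s => f s i)) -> continuous f.
Proof.
move=> cf s; apply/cvg_sup => i.
exact: (@continuous_comp_initial _ _ _ (fun w : prod_topology K => w i) f (cf i)).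
Qed.

End product.
Section weak_star_topology.
Context {R : realType} {d : nat} {X : set 'rV[R]_d}.
Context {oX : open X} {alpha : {posnum R}}.
Local Notation B := (Bspace oX alpha).
Local Notation E := (Espace oX alpha).
Local Notation leb := (lebesgue_rV d).
Local Notation a := (expR alpha%:num).

Let mX : measurable X := rV_open_measurable oX.

(** Extension by zero turns an integrable function on [X] into an index of the
weak-star pairing. *)
Lemma Lfun1_restrict (f : 'rV[R]_d -> R) :
  leb.-integrable X (EFin \o f) -> f \_ X \in Lfun (lebesgue_on oX) 1.
Proof.
move=> /integrableP[/measurable_EFinP mf fi]; apply/Lfun1_integrable.
have mfX : measurable_fun setT (f \_ X).
  by apply/(measurable_restrictT f mX).
apply/integrableP; split; first exact/measurable_EFinP.
apply: le_lt_trans fi.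
rewrite -(@eq_measure_integral _ _ _ _ leb (lebesgue_on oX)); last first.
  by move=> A mA AX; rewrite /lebesgue_on /= /mrestr setIidl.
rewrite [leRHS]integral_mkcond le_eqVlt; apply/orP; left; apply/eqP.
apply: eq_integral => x _; rewrite /= !patchE.
by case: ifP => //= _; rewrite normr0.
Qed.

Lemma pairing_continuous (f : LfunType (lebesgue_on oX) (lexx 1%E)) :
  continuous (fun v : Linfty oX => weak_star_pairing v f : R).
Proof.
move=> v; apply: (@continuous_comp _ _ _ (@weak_star_pairing _ _ _ oX)
  (fun w : prod_topology _ => w f)); first exact: initial_continuous.
exact: prod_eval_continuous.
Qed.

Lemma Lfun1_integrableX (f : LfunType (lebesgue_on oX) (lexx 1%E)) :
  leb.-integrable X (EFin \o f).
Proof.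
have /Lfun1_integrable/integrableP[mf fi] := LfunP f.
apply/integrableP; split; first exact: measurable_funTS.
apply: le_lt_trans fi.
rewrite (@eq_measure_integral _ _ _ _ (lebesgue_on oX) leb); last first.
  by move=> A mA AX; rewrite /lebesgue_on /= /mrestr setIidl.
by apply: ge0_subset_integral => //; exact: measurableT_comp.
Qed.

Lemma Bspace_val_continuous : continuous (@Bspace_val _ _ _ oX alpha).
Proof. exact: initial_continuous. Qed.

Lemma Espace_val_continuous : continuous (@Espace_val _ _ _ oX alpha).
Proof. exact: initial_continuous. Qed.

Lemma Rintegral_continuous (f : 'rV[R]_d -> R) :
  leb.-integrable X (EFin \o f) ->
  continuous (fun r : B => \int[leb]_(x in X) (f x * r x)).
Proof.
move=> fi r.
pose g : LfunType (lebesgue_on oX) (lexx 1%E) := Lfun_Sub _ (Lfun1_restrict fi).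
have -> : (fun r : B => \int[leb]_(x in X) (f x * r x)) =
    (fun v : Linfty oX => weak_star_pairing v g : R) \o @Bspace_val _ _ _ oX alpha.
  apply/funext => r' /=; apply: eq_Rintegral => x xX.
  by rewrite /g /= patchE xX.
apply: continuous_comp; first exact: Bspace_val_continuous.
exact: pairing_continuous.
Qed.

(** The coordinates of the pairing of [T r] are affine in those of [r]. *)
Lemma TB_continuous : continuous (@TB _ _ _ oX alpha).
Proof.
apply: (@continuous_comp_initial B B (Linfty oX)).
apply: (@continuous_comp_initial _ B _ (@weak_star_pairing _ _ _ oX)).
apply: continuous_prod => f.
have fi := Lfun1_integrableX f.
have -> : (fun r : B => ((@weak_star_pairing _ _ _ oX) \o
    ((@Bspace_val _ _ _ oX alpha) \o (@TB _ _ _ oX alpha))) r f) =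
  (fun r : B => (a + 1) * \int[leb]_(x in X) f x - \int[leb]_(x in X) (f x * r x)).
  by apply/funext => r /=; exact: Rintegral_TB.
move=> r; apply: (@cvg_comp _ _ _ (fun r : B => \int[leb]_(x in X) (f x * r x))
  (fun y : R => (a + 1) * \int[leb]_(x in X) f x - y)).
  exact: Rintegral_continuous.
by apply: cvgB; [exact: cvg_cst|exact: cvg_id].
Qed.

Lemma TE_continuous : continuous (@TE _ _ _ oX alpha).
Proof.
apply: (@continuous_comp_initial E E B).
move=> r; apply: (@continuous_comp _ _ _ (@Espace_val _ _ _ oX alpha)
  (@TB _ _ _ oX alpha)); first exact: Espace_val_continuous.
exact: TB_continuous.
Qed.

Lemma measurable_Espace_val : measurable_fun setT (@Espace_val _ _ _ oX alpha).
Proof.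
apply: (measurability (@open B)) => // _ [U oU <-].
rewrite setTI; apply: sub_sigma_algebra.
by have /continuousP := Espace_val_continuous; exact.
Qed.

Lemma measurable_TE : measurable_fun setT (@TE _ _ _ oX alpha).
Proof.
apply: (measurability (@open E)) => // _ [U oU <-].
rewrite setTI; apply: sub_sigma_algebra.
by have /continuousP := TE_continuous; exact.
Qed.

(** All the functionals of the proof are built from these; being continuous, they
are Borel on E. *)
Lemma measurable_Rintegral (f : 'rV[R]_d -> R) :
  leb.-integrable X (EFin \o f) ->
  measurable_fun setT (fun r : E => \int[leb]_(x in X) (f x * r x)).
Proof.
move=> fi; apply: (measurability _ (RGenOpens.measurableE R)).
move=> _ [_ [u [v ->]] <-]; rewrite setTI; apply: sub_sigma_algebra.
have /continuousP : continuous (fun r : E => \int[leb]_(x in X) (f x * r x)).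
  move=> r; apply: (@continuous_comp _ _ _ (@Espace_val _ _ _ oX alpha)
    (fun r : B => \int[leb]_(x in X) (f x * r x))).
    exact: Espace_val_continuous.
  exact: Rintegral_continuous.
by apply; exact: interval_open.
Qed.

End weak_star_topology.

(** * Two-point measures *)

Section two_point_measures.
Context {R : realType} {d : nat} {X : set 'rV[R]_d}.
Context {oX : open X} {alpha : {posnum R}}.
Local Notation B := (Bspace oX alpha).
Local Notation E := (Espace oX alpha).
Local Notation leb := (lebesgue_rV d).
Local Notation a := (expR alpha%:num).

Let mX : measurable X := rV_open_measurable oX.

(** The indicators of measurable sets of finite measure are integrable, and they
already distinguish classes, because Lebesgue measure is sigma-finite. *)
Lemma Rintegral_separates (r r' : B) :
  (forall f, leb.-integrable X (EFin \o f) ->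
     \int[leb]_(x in X) (f x * r x) = \int[leb]_(x in X) (f x * r' x)) ->
  r = r'.
Proof.
move=> rr'; apply: Bspace_ae_eq.
have /sigma_finiteP[F [FT Fnd mF]] := sigma_finiteT (@lebesgue_rV R d).
have aeF k : {ae leb, forall x, (X `&` F k) x -> r x = r' x}.
  have [mFk Fkoo] := mF k; have mXF := measurableI _ _ mX mFk.
  have indi A : measurable A -> A `<=` X `&` F k ->
      leb.-integrable X (EFin \o (\1_A : _ -> R)).
    move=> mA AXF; apply/integrableP; split.
      exact/measurable_EFinP/measurable_indic.
    under eq_integral do rewrite /= ger0_norm//.
    rewrite integral_indic// (le_lt_trans _ Fkoo)// le_measure ?inE//.
    - exact: measurableI.
    - by move=> x [/AXF[]].
  have clipi (s : B) A : measurable A -> A `<=` X `&` F k ->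
      leb.-integrable A (EFin \o clip s).
    move=> mA AXF; have AX : A `<=` X by move=> x /AXF[].
    apply: (@eq_integrable _ _ _ _ _ mA
      (EFin \o (fun x => \1_A x * clip s x))).
      by move=> x xA /=; rewrite indicE xA mul1r.
    exact: (integrableS mX mA AX (integrable_clip s (indi _ mA AXF))).
  have clip_int (s : B) A : measurable A -> A `<=` X `&` F k ->
      (\int[leb]_(x in A) (clip s x)%:E =
       (\int[leb]_(x in X) (\1_A x * s x))%:E)%E.
    move=> mA AXF; have AX : A `<=` X by move=> x /AXF[].
    rewrite (Rintegral_clip _ (indi _ mA AXF)) /Rintegral fineK; last first.
      exact: (integrable_fin_num mX (integrable_clip s (indi _ mA AXF))).
    rewrite -[in LHS](setIidr AX) integral_mkcondr; apply: eq_integral => x _.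
    by rewrite patchE indicE; case: ifP => _; rewrite ?mul1r ?mul0r.
  have : ae_eq leb (X `&` F k) (EFin \o clip r) (EFin \o clip r').
    apply: integral_ae_eq => //.
    - exact: clipi.
    - by apply/measurable_EFinP; exact: measurable_clip.
    - by move=> A AXF mA /=; rewrite !clip_int// rr'//; exact: indi AXF.
  move=> cc; have := clipE r'; apply: filterS3 cc (clipE r) => x.
  by move=> cc cr cr' [Xx Fx]; rewrite -cr// -cr'//; case: (cc (conj Xx Fx)).
apply: filterS (ae_foralln aeF) => x xF Xx.
have [k _ Fkx] : (\bigcup_k F k) x by rewrite -FT.
exact: (xF k).
Qed.

(** The weak-star topology is T1. This makes finite sets Borel, which inner
regularity of two-point measures requires. *)
Lemma closed_Espace1 (r : E) : closed [set r].
Proof.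
pose D := [set f : 'rV[R]_d -> R | leb.-integrable X (EFin \o f)].
have -> : [set r] = \bigcap_(f in D) [set r' : E |
    \int[leb]_(x in X) (f x * r' x) = \int[leb]_(x in X) (f x * r x)].
  apply/seteqP; split=> [_ -> f _ //|r' /= H].
  by apply: val_inj; apply: Rintegral_separates => f fi; exact: H.
apply: closed_bigI => f fi.
have cf : continuous (fun r' : E => \int[leb]_(x in X) (f x * r' x)).
  move=> s; apply: (@continuous_comp _ _ _ (@Espace_val _ _ _ oX alpha)
    (fun r : B => \int[leb]_(x in X) (f x * r x))).
    exact: Espace_val_continuous.
  exact: Rintegral_continuous.
have /continuous_closedP := cf.
by move/(_ _ (@closed_eq R (\int[leb]_(x in X) (f x * r x)))).
Qed.

Lemma measurable_Espace1 (r : E) : measurable [set r].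
Proof.
rewrite -[X in measurable X]setCK; apply: measurableC.
by apply: sub_sigma_algebra; rewrite openC; exact: closed_Espace1.
Qed.

Lemma two_pointE (r : E) (A : set E) : two_point r A =
  ((1 + a)^-1 * ((r \in A)%:R + (TE r \in A)%:R))%:E.
Proof.
transitivity (((1 + a)^-1)%:E * measure_add (dirac r) (dirac (TE r)) A)%E => //.
by rewrite measure_addE EFinM EFinD; congr (_ * (_ + _))%E; exact: diracE.
Qed.

Lemma ge0_integral_two_point (r : E) (A : set E) (f : E -> \bar R) :
  measurable A -> measurable_fun A f -> (forall z, A z -> 0 <= f z)%E ->
  (\int[two_point r]_(z in A) f z = ((1 + a)^-1)%:E *
    ((r \in A)%:R%:E * f r + (TE r \in A)%:R%:E * f (TE r)))%E.
Proof.
move=> mA mf f0; rewrite ge0_integral_mscale//=; congr (_ * _)%E.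
by rewrite ge0_integral_measure_add// !integral_dirac// !diracE.
Qed.

Lemma integral_two_point (r : E) (A : set E) (f : E -> R) :
  measurable A -> measurable_fun A f ->
  (\int[two_point r]_(z in A) (f z)%:E = ((1 + a)^-1 *
    ((r \in A)%:R * f r + (TE r \in A)%:R * f (TE r)))%:E)%E.
Proof.
move=> mA mf; have mEf : measurable_fun A (EFin \o f) by exact/measurable_EFinP.
rewrite integralE !ge0_integral_two_point//; last 2 first.
- exact: measurable_funeneg.
- exact: measurable_funepos.
have fp z : ((fun z => (f z)%:E)^\+ z = (Num.max (f z) 0)%:E)%E.
  by rewrite funeposE EFin_max.
have fn z : ((fun z => (f z)%:E)^\- z = (Num.max (- f z) 0)%:E)%E.
  by rewrite funenegE EFin_max.
rewrite !fp !fn.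
pose w (g : E -> R) : R := (1 + a)^-1 *
  ((r \in A)%:R * g r + (TE r \in A)%:R * g (TE r)).
transitivity ((w (fun z => Num.max (f z) 0) - w (fun z => Num.max (- f z) 0))%:E).
  by [].
congr EFin; rewrite /w.
(* the integrals of the positive and negative parts are recombined at each atom *)
have maxE (y : R) : Num.max y 0 - Num.max (- y) 0 = y.
  by case: (leP 0 y); case: (leP 0 (- y)); lra.
by rewrite -[in RHS](maxE (f r)) -[in RHS](maxE (f (TE r))); ring.
Qed.

Lemma two_point_symmetric (r : E) : symmetric_measure (two_point r).
Proof.
move=> A mA; rewrite /pushforward !two_pointE.
have memT z : (z \in (@TE _ _ _ oX alpha) @^-1` A) = (TE z \in A).
  by apply/idP/idP; rewrite !inE.
by rewrite !memT TEK; congr EFin; congr (_ * _); exact: addrC.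
Qed.

(** The trace of a set on the two atoms is compact and carries all of its mass. *)
Lemma two_point_radon (r : E) : radon (two_point r).
Proof.
move=> A mA; apply/eqP; rewrite eq_le; apply/andP; split; last first.
  apply: ge_ereal_sup => _ [K [cK mK KA] <-].
  by apply: le_measure; rewrite ?inE.
have mrr : measurable [set r; TE r].
  by apply: measurableU; exact: measurable_Espace1.
apply: ereal_sup_ubound; exists (A `&` [set r; TE r]); last first.
  have memrr z : z = r \/ z = TE r -> (z \in A `&` [set r; TE r]) = (z \in A).
    by move=> zr; apply/idP/idP; rewrite !inE /=; tauto.
  by rewrite !two_pointE !memrr//; [right|left].
split; [|exact: measurableI|exact: subIsetl].
by apply: finite_compact; exact: finite_setIr.
Qed.

End two_point_measures.

(** * Feasible measures and their mass *)

Section subprobabilities.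
Context {R : realType} {d : nat} {X : set 'rV[R]_d}.
Context {oX : open X} {alpha : {posnum R}}.
Local Notation E := (Espace oX alpha).
Local Notation a := (expR alpha%:num).
Variable r : E.

Definition two_point_fun : set E -> \bar R := two_point r.

HB.instance Definition _ := Measure.copy two_point_fun (two_point r).

Let two_point_fun_le1 : (two_point_fun setT <= 1)%E.
Proof.
rewrite /two_point_fun two_pointE !in_setT lee_fin.
have := expR_alpha_ge1 alpha => a1.
have a0 : 0 < 1 + a by lra.
by rewrite -(ler_pM2l a0) mulrA divff ?gt_eqF// mul1r mulr1 lerD2l.
Qed.

HB.instance Definition _ := Measure_isSubProbability.Build _ _ _ two_point_fun
  two_point_fun_le1.

(** The total mass is [2 / (1 + exp(alpha))], which is at most 1. *)
Definition two_point_subprob : subprobability E R := two_point_fun.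

End subprobabilities.

Section mechanisms.
Context {R : realType} {d : nat} {X : set 'rV[R]_d}.
Context {oX : open X} {alpha : {posnum R}}.
Local Notation B := (Bspace oX alpha).
Local Notation E := (Espace oX alpha).
Local Notation leb := (lebesgue_rV d).
Local Notation a := (expR alpha%:num).
Local Notation c := (a + 1).
Implicit Types e : 'rV[R]_d -> B -> R.

Let mX : measurable X := rV_open_measurable oX.

Lemma measurable_eval_l e x : evaluation_operator e -> X x ->
  measurable_fun setT (fun r : E => e x (Espace_val r)).
Proof.
move=> [me _] Xx; have mXT : measurable (X `*` [set: B]) by exact: measurableX.
have mp : measurable_fun setT (fun r : E => (x, Espace_val r)).
  apply/measurable_fun_pairP; split; first exact: measurable_cst.
  exact: measurable_Espace_val.
by apply: (measurable_comp mXT _ me mp) => _ [r _ <-].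
Qed.

Lemma measurable_eval_r e (r : B) : evaluation_operator e ->
  measurable_fun X (fun x => e x r).
Proof.
move=> [me _]; have mXT : measurable (X `*` [set: B]) by exact: measurableX.
have mp : measurable_fun setT (fun x : 'rV[R]_d => (x, r)).
  apply/measurable_fun_pairP; split; first exact: measurable_id.
  exact: measurable_cst.
by apply: (measurable_comp mXT _ me (measurable_funTS mp)) => _ [x Xx <-].
Qed.

(** The evaluation operator agrees with [r] and with [T r] outside one null set,
which does not depend on [A]. *)
Lemma mechanism_two_point e (r : E) : evaluation_operator e ->
  {ae leb, forall x, X x -> forall A, measurable A ->
    mechanism e (two_point r) x A = ((1 + a)^-1 *
      ((r \in A)%:R * r x + (TE r \in A)%:R * (TE r) x))%:E}.
Proof.
move=> ee; have [_ eE] := ee; apply: filterS2 (eE r) (eE (TE r)).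
move=> x er eTr Xx A mA.
rewrite /mechanism integral_two_point//; last first.
  exact: measurable_funTS (measurable_eval_l ee Xx).
by rewrite er// eTr.
Qed.

(** The values [r x] and [T r x] add up to [1 + exp(alpha)]. *)
Lemma two_point_normalized e (r : E) :
  evaluation_operator e -> normalized e (two_point r).
Proof.
move=> ee; apply: filterS2 (mechanism_two_point r ee) (TBE r).
move=> x rx Tr Xx; have := rx Xx _ measurableT; rewrite /mechanism => ->.
rewrite !in_setT !mul1r; congr EFin.
have -> : (TE r) x = a + 1 - r x by exact: Tr.
have : 0 < a by exact: expR_gt0.
by move=> a0; field; lra.
Qed.

Lemma two_point_feasible e (r : E) :
  evaluation_operator e -> feasible e (two_point_subprob r).
Proof.
by move=> ee; split; [exact: two_point_radon|exact: two_point_normalized].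
Qed.

Lemma symmetric_integral (mu : {measure set E -> \bar R}) (g : E -> \bar R) :
  symmetric_measure mu -> measurable_fun setT g -> (forall r, 0 <= g r)%E ->
  (\int[mu]_r g r = \int[mu]_r g (TE r))%E.
Proof.
move=> smu mg g0.
have g0' : {in setT, forall r, (0 <= g r)%E} by move=> r _.
have := ge0_integral_pushforward measurable_TE mu measurableT mg g0'.
rewrite preimage_setT => <-.
apply: eq_measure_integral => [|mT A mA _]; first exact: measurable_TE.
by apply: esym; exact: smu.
Qed.

Section density.
Context {p0 : 'rV[R]_d -> R}.
Hypothesis p0_ge0 : forall x, X x -> 0 <= p0 x.
Hypothesis p0_int : leb.-integrable X (EFin \o p0).
Hypothesis p0_1 : \int[leb]_(x in X) p0 x = 1.

Definition mass (p0 : 'rV[R]_d -> R) (r : B) := \int[leb]_(x in X) (p0 x * r x).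

Lemma mass_bounds (r : B) : 1 <= mass p0 r <= a.
Proof.
rewrite /mass Rintegral_clip//; apply/andP; split.
  rewrite -{1}p0_1; apply: le_Rintegral => //; first exact: integrable_clip.
  move=> x Xx; rewrite ler_peMr ?p0_ge0//.
  by have /andP[] := clip_bounds r x.
rewrite -[leRHS]mulr1 -p0_1 -RintegralZl//.
apply: le_Rintegral => //; first exact: integrable_clip.
- by apply: eq_integrable (integrableZl mX a p0_int).
- move=> x Xx; rewrite mulrC ler_wpM2r ?p0_ge0//.
  by have /andP[] := clip_bounds r x.
Qed.

Lemma mass_TB (r : B) : mass p0 (TB r) = c - mass p0 r.
Proof. by rewrite /mass Rintegral_TB// p0_1 mulr1. Qed.

(** Fubini's theorem for [(x, r) |-> p0 x * e x r] on [X] times E. The evaluation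
operator may be negative on null sets that depend on [r], hence the use of the
integrable version; integrability follows from [mass_bounds] by integrating in
[x] first. *)
Lemma integral_mass e (mu : subprobability E R) :
  evaluation_operator e -> normalized e mu ->
  (\int[mu]_r (mass p0 (Espace_val r))%:E = 1)%E.
Proof.
move=> ee nmu; have [me eE] := ee.
have mXT : measurable (X `*` [set: E]) by exact: measurableX.
have mp0 : measurable_fun X p0.
  by apply/measurable_EFinP; exact: measurable_int p0_int.
pose f : 'rV[R]_d * E -> \bar R :=
  EFin \o ((fun z => p0 z.1 * e z.1 (Espace_val z.2)) \_ (X `*` [set: E])).
have mf : measurable_fun setT f.
  apply/measurable_EFinP; apply/(measurable_restrictT _ mXT).
  apply: measurable_funM.
    apply: (@measurable_comp _ _ _ _ _ _ X p0 _ fst) => //.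
      by move=> _ [[x r] [/= Xx _] <-].
    exact: measurable_funTS.
  have mp : measurable_fun setT
      (fun z : 'rV[R]_d * E => (z.1, Espace_val z.2)).
    apply/measurable_fun_pairP; split; first exact: measurable_fst.
    exact: (measurableT_comp measurable_Espace_val measurable_snd).
  have mXB : measurable (X `*` [set: B]) by exact: measurableX.
  have sub : [set (z.1, Espace_val z.2) | z in X `*` [set: E]]
      `<=` X `*` [set: B] by move=> _ [[x r] [/= Xx _] <-].
  exact: (measurable_comp mXB sub me (measurable_funTS mp)).
have fE x r : f (x, r) = ((fun x => (p0 x * e x (Espace_val r))%:E) \_ X) x.
  have xrX : ((x, r) \in X `*` [set: E]) = (x \in X).
    by apply/idP/idP; rewrite !inE /=; [case|].
  by rewrite /f /= !patchE xrX; case: ifP.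
have fr r : ae_eq leb X (fun x => (p0 x * e x (Espace_val r))%:E)
    (fun x => (p0 x * r x)%:E).
  by apply: filterS (eE r) => x er Xx; rewrite er.
have mpe r : measurable_fun X (fun x => p0 x * e x (Espace_val r)).
  by apply: measurable_funM => //; exact: measurable_eval_r.
have massE r : (\int[leb]_x f (x, r) = (mass p0 (Espace_val r))%:E)%E.
  under eq_integral do rewrite fE.
  rewrite -integral_mkcond (ae_eq_integral _ _ mX _ _ (fr r)).
    by rewrite fineK//; exact: (integrable_fin_num mX (integrable_mulB r p0_int)).
    exact/measurable_EFinP.
  exact: measurable_int (integrable_mulB r p0_int).
have absE r : (\int[leb]_x `|f (x, r)| <= (mass p0 (Espace_val r))%:E)%E.
  rewrite (_ : (fun x => `|f (x, r)|%E) =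
      (fun x => (`|p0 x * e x (Espace_val r)|)%:E) \_ X); last first.
    by apply/funext => x; rewrite fE !patchE; case: ifP => //= _; rewrite normr0.
  rewrite -integral_mkcond.
  rewrite (ae_eq_integral (fun x => (p0 x * clip r x)%:E))//.
  - rewrite /mass Rintegral_clip// fineK//.
    exact: (integrable_fin_num mX (integrable_clip r p0_int)).
  - by apply/measurable_EFinP; exact: measurableT_comp.
  - exact: measurable_int (integrable_clip r p0_int).
  - apply: filterS2 (eE r) (clipE r) => x er cr Xx; rewrite er// -cr//.
    rewrite ger0_norm// mulr_ge0 ?p0_ge0//.
    by have /andP[+ _] := clip_bounds r x; exact: le_trans.
have fi : (leb \x mu)%E.-integrable setT f.
  apply/integrable21ltyP => //.
  apply: (@le_lt_trans _ _ (\int[mu]_(r in setT) (cst a%:E) r)%E).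
    apply: ge0_le_integral => //.
    - by move=> r _; exact: integral_ge0.
    - apply: (@measurable_fun_fubini_tonelli_G _ _ _ _ _ leb (abse \o f)) => //.
        exact: measurableT_comp.
      by move=> z; exact: abse_ge0.
    - by move=> r _; apply: le_trans (absE r) _; rewrite lee_fin;
        have /andP[] := mass_bounds (Espace_val r).
  rewrite integral_cst// lte_mul_pinfty ?lee_fin ?expR_ge0//.
  by rewrite (le_lt_trans (@sprobability_setT _ _ _ mu))// ltry.
have := @Fubini _ _ _ _ _ leb mu f fi.
under [RHS]eq_integral do rewrite massE.
move=> <-.
have fp0 : (\int[leb]_(x in X) (p0 x)%:E)%E \is a fin_num.
  exact: (integrable_fin_num mX p0_int).
transitivity (\int[leb]_(x in X) (p0 x)%:E)%E; last first.
  by rewrite -p0_1 /Rintegral fineK.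
rewrite [RHS]integral_mkcond; apply: ae_eq_integral => //.
- exact: (measurable_fubini_F fi).
- by apply/(measurable_restrictT _ mX)/measurable_EFinP.
apply: filterS nmu => x ex _.
rewrite patchE; case: ifPn => xX; last first.
  under eq_integral do rewrite fE patchE (negbTE xX).
  exact: integral0.
have Xx : X x by rewrite inE in xX.
under eq_integral do rewrite fE patchE xX EFinM.
rewrite integralZl//; first by rewrite ex// mule1.
apply/integrableP; split.
  by apply/measurable_EFinP; exact: (measurable_eval_l ee Xx).
rewrite integral_fin_num_abs//; first by rewrite ex.
exact: (measurable_eval_l ee Xx).
Qed.

(** The integral of [m(r) + m(T r)], which is constantly [c], is 2 by [integral_mass]. *)
Lemma symmetric_mass e (mu : subprobability E R) :
  evaluation_operator e -> normalized e mu -> symmetric_measure mu ->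
  mu setT = (2 / c)%:E.
Proof.
move=> ee nmu smu; have a0 : 0 < a by exact: expR_gt0.
have mm : measurable_fun setT (fun r : E => (mass p0 r)%:E).
  by apply/measurable_EFinP; exact: measurable_Rintegral.
have m0 r : (0 <= (mass p0 r)%:E)%E.
  by have /andP[+ _] := mass_bounds r; rewrite lee_fin; exact: le_trans.
have h1 := integral_mass ee nmu.
have h2 : (\int[mu]_r (mass p0 (TE r))%:E = 1)%E.
  by rewrite -(@symmetric_integral mu (fun r => (mass p0 r)%:E)).
have : (\int[mu]_r ((mass p0 (Espace_val r))%:E + (mass p0 (TE r))%:E) = 2%:E)%E.
  rewrite ge0_integralD//; last first.
    by apply: (measurableT_comp mm); exact: measurable_TE.
  by rewrite h1 h2.
rewrite (_ : (fun r => _) = cst c%:E); last first.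
  by apply/funext => r; rewrite -EFinD (mass_TB (Espace_val r)) addrC subrK.
rewrite integral_cst// => h.
have {h} : (c%:E * mu setT = 2%:E)%E by exact: h.
have /fineK <- := fin_num_measure mu _ measurableT.
move: (fine _) => y /(congr1 fine) /= cy; congr EFin.
have c0 : c != 0 by rewrite gt_eqF// ltr_wpDr.
apply: (mulfI c0); rewrite mulrCA divff// mulr1; exact: cy.
Qed.

End density.
End mechanisms.

(** * The information functional *)

Section information.
Context {R : realType} {d : nat} {X : set 'rV[R]_d}.
Context {oX : open X} {alpha : {posnum R}}.
Local Notation B := (Bspace oX alpha).
Local Notation E := (Espace oX alpha).
Local Notation leb := (lebesgue_rV d).
Local Notation a := (expR alpha%:num).
Local Notation c := (a + 1).

Let mX : measurable X := rV_open_measurable oX.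

(** The integrand is maximized pointwise by taking the largest value of [r] where
[g] is positive and the smallest one elsewhere, and this choice is in E. *)
Lemma linear_maximizer (g : 'rV[R]_d -> R) : leb.-integrable X (EFin \o g) ->
  exists t : E, forall r : B,
    \int[leb]_(x in X) (g x * r x) <= \int[leb]_(x in X) (g x * t x).
Proof.
move=> gi; have mg : measurable_fun X g.
  by apply/measurable_EFinP; exact: measurable_int gi.
pose A := X `&` [set x | 0 < g x].
have mA : measurable A.
  rewrite /A (_ : [set x | 0 < g x] = g @^-1` `]0, +oo[%classic).
    by apply: mg => //; exact: measurable_itv.
  by apply/seteqP; split=> x /=; rewrite in_itv /= andbT.
pose f x : R := 1 + (a - 1) * \1_A x.
have fA x : A x -> f x = a by move=> Ax; rewrite /f indicE mem_set// mulr1 addrC subrK.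
have fNA x : ~ A x -> f x = 1 by move=> Ax; rewrite /f indicE memNset// mulr0 addr0.
have mf : measurable_fun setT f.
  apply: measurable_funD; first exact: measurable_cst.
  by apply: measurable_funM; [exact: measurable_cst|exact: measurable_indic].
have a1 := expR_alpha_ge1 alpha.
have fb : {ae leb, forall x, X x -> 1 <= f x <= a}.
  apply: aeW => x _; have [Ax|Ax] := pselect (A x).
    by rewrite fA// a1 lexx.
  by rewrite fNA// lexx a1.
pose t0 : B := Bclass oX mf fb.
have t0E : {ae leb, forall x, X x -> t0 x = f x} by exact: BclassE.
have t0Eset : Eset t0.
  apply: filterS t0E => x tx Xx; rewrite tx//.
  by have [Ax|Ax] := pselect (A x); [right; exact: fA|left; exact: fNA].
have gfi : leb.-integrable X (EFin \o (fun x => g x * f x)).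
  apply: (ae_eq_integrable mX _ _ (integrable_mulB t0 gi)).
    by apply/measurable_EFinP; apply: measurable_funM => //; exact: measurable_funTS.
  by apply: filterS t0E => x tx Xx /=; rewrite tx.
exists (exist _ t0 (mem_set t0Eset)) => r.
have -> : \int[leb]_(x in X) (g x * t0 x) = \int[leb]_(x in X) (g x * f x).
  congr fine; apply: ae_eq_integral => //.
  - exact: measurable_int (integrable_mulB t0 gi).
  - exact: measurable_int gfi.
  - by apply: filterS t0E => x tx Xx /=; rewrite tx.
rewrite Rintegral_clip//; apply: le_Rintegral => //.
  exact: integrable_clip.
move=> x Xx; have /andP[r1 ra] := clip_bounds r x.
have [Ax|Ax] := pselect (A x).
  by rewrite fA// ler_wpM2l//; case: Ax => _ /ltW.
rewrite fNA// ler_wnM2l//.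
by rewrite leNgt; apply/negP => gx; exact: Ax.
Qed.

Section score.
Context {s p0 : 'rV[R]_d -> R}.
Hypothesis p0_ge0 : forall x, X x -> 0 <= p0 x.
Hypothesis p0_int : leb.-integrable X (EFin \o p0).
Hypothesis p0_1 : \int[leb]_(x in X) p0 x = 1.
Hypothesis sp_int : leb.-integrable X (EFin \o (fun x => s x * p0 x)).
Hypothesis sp_0 : \int[leb]_(x in X) (s x * p0 x) = 0.

Definition drift (s p0 : 'rV[R]_d -> R) (r : B) :=
  \int[leb]_(x in X) (s x * p0 x * r x).

Lemma infoE (r : B) : info s p0 r = drift s p0 r ^+ 2 / mass p0 r.
Proof.
rewrite /info /drift /mass.
under eq_Rintegral do rewrite mulrAC.
by under [in X in _ / X = _]eq_Rintegral do rewrite mulrC.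
Qed.

Lemma drift_TB (r : B) : drift s p0 (TB r) = - drift s p0 r.
Proof. by rewrite /drift Rintegral_TB// sp_0 mulr0 add0r. Qed.

Let mass_gt0 (r : B) : 0 < mass p0 r.
Proof.
by have /andP[+ _] := mass_bounds p0_ge0 p0_int p0_1 r; exact: lt_le_trans.
Qed.

Let massC_gt0 (r : B) : 0 < c - mass p0 r.
Proof. by rewrite -(mass_TB p0_int p0_1). Qed.

Lemma info_ge0 (r : B) : 0 <= info s p0 r.
Proof. by rewrite infoE divr_ge0 ?sqr_ge0// ltW. Qed.

Lemma info_TB (r : B) : info s p0 (TB r) = drift s p0 r ^+ 2 / (c - mass p0 r).
Proof. by rewrite infoE drift_TB (mass_TB p0_int p0_1) sqrrN. Qed.

(** The numerator is bounded since [s * p0] is integrable, and the denominator is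
at least 1. *)
Lemma info_bounded : exists K : R, forall r : B, info s p0 r <= K.
Proof.
pose f x := `|s x * p0 x|.
have fi : leb.-integrable X (EFin \o f).
  have := integrable_abse sp_int; apply: eq_integrable => // x _ /=.
exists ((a * \int[leb]_(x in X) f x) ^+ 2) => r.
have Dle : `|drift s p0 r| <= a * \int[leb]_(x in X) f x.
  rewrite /drift Rintegral_clip//.
  apply: le_trans (le_normr_Rintegral mX (integrable_clip r sp_int)) _.
  rewrite -RintegralZl//; apply: le_Rintegral => //.
  - have := integrable_abse (integrable_clip r sp_int).
    by apply: eq_integrable => // x _ /=.
  - by apply: eq_integrable (integrableZl mX a fi).
  - move=> x Xx; have /andP[r1 ra] := clip_bounds r x.
    rewrite normrM mulrC ler_wpM2r// ger0_norm//; exact: le_trans r1.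
rewrite infoE ler_pdivrMr//.
apply: (@le_trans _ _ ((a * \int[leb]_(x in X) f x) ^+ 2)).
  by rewrite -real_normK ?num_real// ler_pXn2r// nnegrE (le_trans _ Dle).
by rewrite ler_peMr ?sqr_ge0//; have /andP[] := mass_bounds p0_ge0 p0_int p0_1 r.
Qed.

(** The tangent plane of the convex function [D^2 / m], of slope [2 l] in [D]; it
is attained at [D = l m]. *)
Lemma le_perspective (D m l : R) : 0 < m ->
  2 * l * D - l ^+ 2 * m <= D ^+ 2 / m.
Proof.
move=> m0; rewrite ler_pdivlMr//.
by have := sqr_ge0 (D - l * m); lra.
Qed.

(** The parameters [l] and [l'] select the tangents at [r] for the two terms of
[i^(s)]. The sum of these tangents is a linear functional plus a constant, lies
below twice [i^(s)] and equals it at [r], so a maximizer of the functional does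
at least as well as [r]. *)
Lemma info_sym_thresholded (r : B) :
  exists t : E, info_sym s p0 r <= info_sym s p0 t.
Proof.
set D := drift s p0 r; set m := mass p0 r.
pose l := D / m; pose l' := - D / (c - m).
pose g x := 2 * (l - l') * (s x * p0 x) - (l ^+ 2 - l' ^+ 2) * p0 x.
have gi : leb.-integrable X (EFin \o g).
  have := integrableB mX (integrableZl mX (2 * (l - l')) sp_int)
    (integrableZl mX (l ^+ 2 - l' ^+ 2) p0_int).
  by apply: eq_integrable => // x _ /=.
have gE (q : B) : \int[leb]_(x in X) (g x * q x) =
    2 * (l - l') * drift s p0 q - (l ^+ 2 - l' ^+ 2) * mass p0 q.
  rewrite /drift /mass -!RintegralZl//; try exact: integrable_mulB.
  rewrite -RintegralB//.
  - by apply: eq_Rintegral => x _; rewrite /g; ring.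
  - apply: eq_integrable (integrableZl mX (2 * (l - l')) (integrable_mulB q sp_int)) => //.
  - apply: eq_integrable (integrableZl mX (l ^+ 2 - l' ^+ 2) (integrable_mulB q p0_int)) => //.
have [t tmax] := linear_maximizer gi; exists t.
have := tmax r; rewrite !gE -/D -/m => Lrt.
rewrite /info_sym ler_pM2l ?invr_gt0//.
have -> : info s p0 r + info s p0 (TB r) =
    2 * (l - l') * D - (l ^+ 2 - l' ^+ 2) * m - l' ^+ 2 * c.
  rewrite info_TB infoE -/D -/m /l /l'.
  by field; rewrite !gt_eqF// ?massC_gt0// /m mass_gt0.
have P1 := le_perspective (drift s p0 t) l (mass_gt0 t).
have P2 := le_perspective (- drift s p0 t) l' (massC_gt0 t).
rewrite info_TB infoE; rewrite sqrrN in P2.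
apply: le_trans (lerD P1 P2); lra.
Qed.

Lemma measurable_info : measurable_fun setT (fun r : E => info s p0 r).
Proof.
(* the inverse is written as a power, which is known to be measurable *)
have -> : (fun r : E => info s p0 r) =
    (fun r : E => drift s p0 r ^+ 2 * mass p0 r `^ (- 1)).
  by apply/funext => r; rewrite powR_inv1 ?ltW// infoE.
apply: measurable_funM.
  by apply: measurable_funX; exact: measurable_Rintegral.
apply: (measurableT_comp (measurable_powR (- 1))).
exact: measurable_Rintegral.
Qed.

Lemma info_integral_two_point (r : E) :
  info_integral s p0 (two_point r) = (2 / c * info_sym s p0 r)%:E.
Proof.
rewrite /info_integral integral_two_point//; last exact: measurable_info.
rewrite !in_setT !mul1r; congr EFin.
rewrite /info_sym /= /TE /Espace_val /=.
have -> : 1 + a = c by rewrite addrC.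
by field.
Qed.

Lemma info_integral_fin_num (mu : subprobability E R) :
  info_integral s p0 mu \is a fin_num.
Proof.
have i0 (r : E) : setT r -> (0 <= (info s p0 r)%:E)%E.
  by move=> _; rewrite lee_fin info_ge0.
rewrite ge0_fin_numE; last exact: integral_ge0.
have [K iK] := info_bounded; have K0 := le_trans (info_ge0 (@Bone _ _ _ oX alpha)) (iK _).
apply: (@le_lt_trans _ _ (\int[mu]_r (cst K%:E) r)%E).
  apply: ge0_le_integral => //.
  - by apply/measurable_EFinP; exact: measurable_info.
  - by move=> r _; rewrite lee_fin.
rewrite integral_cst// lte_mul_pinfty ?lee_fin//.
by rewrite (le_lt_trans (@sprobability_setT _ _ _ mu))// ltry.
Qed.

(** By symmetry [i] and its composition with [T] have the same integral. *)
Lemma info_integral_symmetric (mu : subprobability E R) :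
  symmetric_measure mu ->
  info_integral s p0 mu = (\int[mu]_r (info_sym s p0 (Espace_val r))%:E)%E.
Proof.
move=> smu; have mi := measurable_info.
have mEi : measurable_fun setT (fun r : E => (info s p0 r)%:E).
  exact/measurable_EFinP.
have iT : (\int[mu]_r (info s p0 (TB (Espace_val r)))%:E =
    info_integral s p0 mu)%E.
  by rewrite /info_integral (@symmetric_integral _ _ _ _ _ mu (fun r => (info s p0 (Espace_val r))%:E))//;
    move=> r; rewrite lee_fin info_ge0.
under eq_integral do rewrite /info_sym EFinM EFinD.
have miT : measurable_fun setT (fun r : E => (info s p0 (TB r))%:E).
  exact: (measurableT_comp mEi measurable_TE).
rewrite ge0_integralZl//; last 2 first.
- exact: emeasurable_funD.
- by move=> r _; rewrite adde_ge0// lee_fin info_ge0.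
rewrite ge0_integralD//; last 2 first.
- by move=> r _; rewrite lee_fin info_ge0.
- by move=> r _; rewrite lee_fin info_ge0.
rewrite iT -/(info_integral s p0 mu); have /fineK <- := info_integral_fin_num mu.
move: (fine _) => y.
transitivity ((2^-1 * (y + y))%:E); last by [].
by congr EFin; field.
Qed.

End score.
End information.

(** * The optimum over E *)

Section optimum.
Context {R : realType} {d : nat} {X : set 'rV[R]_d}.
Context {oX : open X} {alpha : {posnum R}}.
Local Notation B := (Bspace oX alpha).
Local Notation E := (Espace oX alpha).
Local Notation leb := (lebesgue_rV d).
Local Notation a := (expR alpha%:num).
Local Notation c := (a + 1).
Context {s p0 : 'rV[R]_d -> R} {e : 'rV[R]_d -> B -> R}.
Hypothesis p0_ge0 : forall x, X x -> 0 <= p0 x.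
Hypothesis p0_int : leb.-integrable X (EFin \o p0).
Hypothesis p0_1 : \int[leb]_(x in X) p0 x = 1.
Hypothesis sp_int : leb.-integrable X (EFin \o (fun x => s x * p0 x)).
Hypothesis ee : evaluation_operator e.

Lemma two_point_le_Jmax (r : E) :
  ((2 / c * info_sym s p0 r)%:E <= Jmax e s p0)%E.
Proof.
rewrite -(info_integral_two_point p0_ge0 p0_int p0_1 sp_int).
apply: ereal_sup_ubound.
by exists (two_point_subprob r) => //; exact: two_point_feasible.
Qed.

(** [M] below bounds [i^(s)] on E because of the two-point measures, and [mubar]
of mass [2 / c] integrates [i^(s)] to [2 / c * M]. Hence [M - i^(s)] vanishes
[mubar]-almost everywhere, thus somewhere. *)
Lemma symmetric_optimum (mubar : subprobability E R) :
  normalized e mubar -> info_integral s p0 mubar = Jmax e s p0 ->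
  symmetric_measure mubar ->
  exists rbar : E, (2 / c * info_sym s p0 rbar)%:E = Jmax e s p0 /\
    forall r : E, info_sym s p0 r <= info_sym s p0 rbar.
Proof.
move=> nmu muJ smu.
have c0 : 0 < c by rewrite ltr_wpDr.
have mmu := symmetric_mass p0_ge0 p0_int p0_1 ee nmu smu.
have symI := info_integral_symmetric p0_ge0 p0_int p0_1 sp_int smu.
have /fineK := info_integral_fin_num p0_ge0 p0_int p0_1 sp_int mubar.
set j := fine _ => jE; pose M := c / 2 * j.
have JE : Jmax e s p0 = j%:E by rewrite -muJ jE.
have isM (r : E) : info_sym s p0 r <= M.
  have := two_point_le_Jmax r; rewrite JE lee_fin /M => h.
  have -> : info_sym s p0 r = c / 2 * (2 / c * info_sym s p0 r).
    by field; rewrite gt_eqF.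
  by rewrite ler_wpM2l// divr_ge0// ltW.
have is0 (r : E) : 0 <= info_sym s p0 r.
  rewrite /info_sym mulr_ge0 ?invr_ge0// addr_ge0//.
    exact: (info_ge0 p0_ge0 p0_int p0_1).
  exact: (info_ge0 p0_ge0 p0_int p0_1).
have mi : measurable_fun setT (fun r : E => info s p0 r).
  exact: (measurable_info p0_ge0 p0_int p0_1 sp_int).
have mis : measurable_fun setT (fun r : E => info_sym s p0 r).
  have miT : measurable_fun setT (fun r : E => info s p0 (TB r)).
    exact: (measurableT_comp mi measurable_TE).
  apply: measurable_funM; first exact: measurable_cst.
  exact: measurable_funD.
have mg : measurable_fun setT (fun r : E => M - info_sym s p0 r).
  by apply: measurable_funB => //; exact: measurable_cst.
have mEg : measurable_fun setT (fun r : E => (M - info_sym s p0 r)%:E).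
  exact/measurable_EFinP.
have g0 : (\int[mubar]_r (M - info_sym s p0 (Espace_val r))%:E = 0)%E.
  have : (\int[mubar]_r ((M - info_sym s p0 (Espace_val r))%:E +
      (info_sym s p0 (Espace_val r))%:E) = j%:E)%E.
    under eq_integral do rewrite -EFinD subrK.
    transitivity (M%:E * (2 / c)%:E)%E.
      by rewrite -mmu; exact: (integral_cst mubar measurableT M%:E).
    by rewrite -EFinM; congr EFin; rewrite /M; field; rewrite gt_eqF.
  rewrite ge0_integralD//; last 3 first.
  - by move=> r _; rewrite lee_fin subr_ge0.
  - by move=> r _; rewrite lee_fin.
  - exact/measurable_EFinP.
  rewrite -symI -jE; move: (\int[mubar]_r _)%E.
  by case=> [y| |] //= [yj]; congr EFin; apply: (addIr j); rewrite add0r.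
have [[r rM]|noM] := pselect (exists r : E, info_sym s p0 r = M).
  exists r; split; last by move=> r'; rewrite rM.
  by rewrite rM JE /M; congr EFin; field; rewrite gt_eqF.
exfalso.
have /(ae_eq_integral_abs mubar measurableT mEg) :
    (\int[mubar]_r `|(M - info_sym s p0 (Espace_val r))%:E| = 0)%E.
  rewrite -[RHS]g0; apply: eq_integral => r _.
  by rewrite gee0_abs// lee_fin subr_ge0.
move=> [N [mN N0 NT]].
have : mubar setT = 0%E.
  rewrite (_ : setT = N)//; apply/seteqP; split=> // r _; apply: NT => /= /(_ I).
  move=> [/eqP]; rewrite subr_eq0 => /eqP Mr; apply: noM.
  by exists r.
by move=> m0; have := mmu; rewrite m0 => -[/eqP]; rewrite eq_sym mulf_eq0 invr_eq0 (gt_eqF c0) pnatr_eq0.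
Qed.

End optimum.

(** * Elementary inequalities *)

Section real_inequalities.
Context {R : realFieldType}.
Implicit Types u v w h k : R.

(** With [u] and [v] the square roots of two densities and [w] the score, this
bounds the squared score by integrable quantities. *)
Lemma score_sqr_le u v w h : 0 <= u -> 0 <= v ->
  h ^+ 2 * (w ^+ 2 * u ^+ 2) <=
  8 * (v ^+ 2 + u ^+ 2 + (v - u - 2^-1 * h * w * u) ^+ 2).
Proof.
move=> u0 v0; set y := 2^-1 * h * w * u.
have -> : h ^+ 2 * (w ^+ 2 * u ^+ 2) = 4 * y ^+ 2 by rewrite /y; field.
have := sqr_ge0 (2 * (v - u) - y); have := mulr_ge0 u0 v0.
move: y => y; nra.
Qed.

(** Here [v^2 - u^2 - h w u^2 = 2 u z + (y + z)^2] with [y = h w u / 2] and [z] the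
remainder of [v]. The parameter [k], proportional to [h] in the application,
balances the two sides of the bound [2 u z <= k u^2 + z^2 / k]. *)
Lemma density_increment_le u v w h k : 0 < k ->
  `|v ^+ 2 - u ^+ 2 - h * (w * u ^+ 2)| <=
  k * u ^+ 2 + (k^-1 + 2) * (v - u - 2^-1 * h * w * u) ^+ 2 +
  2^-1 * h ^+ 2 * (w ^+ 2 * u ^+ 2).
Proof.
move=> k0; set z := v - u - _; set y := 2^-1 * h * w * u.
have zE : z = v - u - y by [].
have -> : v ^+ 2 - u ^+ 2 - h * (w * u ^+ 2) = 2 * u * z + (y + z) ^+ 2.
  by rewrite zE /y; field.
have -> : 2^-1 * h ^+ 2 * (w ^+ 2 * u ^+ 2) = 2 * y ^+ 2 by rewrite /y; field.
have kz : (k^-1 + 2) * z ^+ 2 = k * (z / k) ^+ 2 + 2 * z ^+ 2.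
  by field; rewrite gt_eqF.
have zk : z = k * (z / k) by field; rewrite gt_eqF.
have H1 := mulr_ge0 (ltW k0) (sqr_ge0 (u - z / k)).
have H2 := mulr_ge0 (ltW k0) (sqr_ge0 (u + z / k)).
have H3 := sqr_ge0 (y - z); have H4 := sqr_ge0 (y + z).
have uz : 2 * u * z = 2 * k * (u * (z / k)) by rewrite {1}zk; ring.
rewrite kz uz; move: (z / k) H1 H2 => t H1 H2.
by rewrite ler_norml; apply/andP; split; nra.
Qed.

(** An expansion of the square root on [1, +oo[ with an explicit remainder: [y^2]
has derivative [D] in the direction of [h], and [y] then has [D / (2 y)]. *)
Lemma sqrt_increment_le (x y D h k : R) : 1 <= x -> 1 <= y -> 0 < k <= 1 ->
  `|h| * (1 + `|D|) ^+ 2 <= k ->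
  `|x ^+ 2 - y ^+ 2 - h * D| <= k * `|h| ->
  `|x - y - 2^-1 * h * (D / y)| <= k * `|h|.
Proof.
move=> x1 y1 /andP[k0 k1] hk; set q := x ^+ 2 - y ^+ 2 - h * D => qk.
have xy : 0 < x + y by lra.
have y0 : 0 < y by lra.
have dE : x - y = (h * D + q) / (x + y) by rewrite /q; field; rewrite gt_eqF.
have inv2 z : `|z / (x + y)| <= `|z| / 2.
  rewrite normrM normfV (gtr0_norm xy) ler_wpM2l// lef_pV2 ?posrE//; lra.
have dle : `|x - y| <= `|h| * (1 + `|D|).
  rewrite dE; apply: le_trans (inv2 _) _.
  have := ler_normD (h * D) q; rewrite normrM => hq.
  have := normr_ge0 h; have := normr_ge0 D; have := normr_ge0 q.
  by move: `|h * D + q| `|h| `|D| `|q| hq qk => A b1 b2 b3; nra.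
have -> : x - y - 2^-1 * h * (D / y) =
    q / (x + y) - h * D * (x - y) / (2 * y * (x + y)).
  by rewrite /q; field; rewrite !gt_eqF.
have -> : h * D * (x - y) / (2 * y * (x + y)) =
    (h * D * (x - y) / (2 * y)) / (x + y) by field; rewrite !gt_eqF.
apply: le_trans (ler_normB _ _) _.
have H1 := inv2 q; have H2 := inv2 (h * D * (x - y) / (2 * y)).
have H3 : `|h * D * (x - y) / (2 * y)| <= `|h * D * (x - y)| / 2.
  rewrite normrM normfV (gtr0_norm (_ : 0 < 2 * y)) ?mulr_gt0//.
  by rewrite ler_wpM2l// lef_pV2 ?posrE ?mulr_gt0//; lra.
have H4 : `|h * D * (x - y)| <= `|h| * k.
  rewrite -mulrA normrM ler_wpM2l// normrM; apply: le_trans hk.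
  have := ler_wpM2l (normr_ge0 D) dle; have := normr_ge0 h.
  have := normr_ge0 D.
  by move: `|x - y| `|h| `|D| => A b1 b2; nra.
move: H1 H2 H3 H4; set A1 := `|q / _|; set A2 := `|_ / (x + y)|.
set A3 := `|_ / (2 * y)|; set A4 := `|h * D * _|.
have := mulr_ge0 (ltW k0) (normr_ge0 h); move: qk; lra.
Qed.

End real_inequalities.

(** * Differentiability in quadratic mean *)

Section quadratic_mean.
Context d (T : measurableType d) (R : realType).
Context (mu : {measure set T -> \bar R}) (D : set T) (mD : measurable D).
Context (Theta : set R) (p : R -> T -> R) (theta0 : R) (s : T -> R).
Hypothesis dens : density_model mu D Theta p.
Hypothesis intTheta : interior Theta theta0.
Hypothesis dqms : dqm mu D p theta0 s.
Local Notation p0 := (p theta0).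

Lemma density_integrable theta : Theta theta ->
  mu.-integrable D (EFin \o p theta).
Proof.
move=> /dens[mp pge0 p1]; apply/integrableP; split; first exact/measurable_EFinP.
rewrite (@eq_integral _ _ _ _ _ (EFin \o p theta)) ?p1 ?ltry//.
by move=> x /[!inE] Dx /=; rewrite ger0_norm// pge0.
Qed.

Lemma Rintegral_density theta : Theta theta -> \int[mu]_(x in D) p theta x = 1.
Proof. by move=> /dens[_ _ p1]; rewrite /Rintegral p1. Qed.

Let Theta0 : Theta theta0. Proof. exact: nbhs_singleton intTheta. Qed.

Let ms : measurable_fun D s. Proof. by case: dqms. Qed.

Let mp0 : measurable_fun D p0. Proof. by have [] := dens Theta0. Qed.

Let p0_ge0 x : D x -> 0 <= p0 x. Proof. by have [_ + _] := dens Theta0; apply. Qed.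

Lemma near_parameter : \forall h \near (0 : R), Theta (theta0 + h).
Proof.
have : (fun h : R => theta0 + h) @ (0 : R) --> theta0.
  rewrite -[X in _ --> X]addr0.
  by apply: cvgD; [exact: cvg_cst|exact: cvg_id].
by apply; exact: intTheta.
Qed.

Lemma measurable_sqrt_density theta : Theta theta ->
  measurable_fun D (fun x => Num.sqrt (p theta x)).
Proof.
move=> /dens[mp _ _]; apply: (measurableT_comp _ mp).
by apply: continuous_measurable_fun; exact: sqrt_continuous.
Qed.

Let rem h x := Num.sqrt (p (theta0 + h) x) - Num.sqrt (p0 x)
  - 2^-1 * h * s x * Num.sqrt (p0 x).

Let measurable_rem h : Theta (theta0 + h) -> measurable_fun D (rem h).
Proof.
move=> Th; apply: measurable_funB.
  by apply: measurable_funB; exact: measurable_sqrt_density.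
apply: measurable_funM; last exact: measurable_sqrt_density.
by apply: measurable_funM => //; exact: measurable_cst.
Qed.

Let remainder_small (eps : R) : 0 < eps -> \forall h \near (0 : R),
  [/\ Theta (theta0 + h), mu.-integrable D (EFin \o (fun x => rem h x ^+ 2)) &
      \int[mu]_(x in D) (rem h x ^+ 2) <= eps * h ^+ 2].
Proof.
move=> eps0; have [_ /(_ _ eps0)] := dqms.
apply: filterS2 near_parameter => h Th remh.
have remge0 : (0 <= \int[mu]_(x in D) (rem h x ^+ 2)%:E)%E.
  by apply: integral_ge0 => x _; rewrite lee_fin sqr_ge0.
have remfin : (\int[mu]_(x in D) (rem h x ^+ 2)%:E < +oo)%E.
  by apply: le_lt_trans remh _; exact: ltry.
split=> //.
- apply/integrableP; split.
    by apply/measurable_EFinP/measurable_funX; exact: measurable_rem.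
  rewrite (@eq_integral _ _ _ _ _ (EFin \o (fun x => rem h x ^+ 2)))//.
  by move=> x _ /=; rewrite ger0_norm// sqr_ge0.
- by rewrite -lee_fin /Rintegral fineK// ge0_fin_numE.
Qed.

Let integrableZ_EFin k (f : T -> R) : mu.-integrable D (EFin \o f) ->
  mu.-integrable D (EFin \o (fun x => k * f x)).
Proof. by move=> fi; apply: eq_integrable (integrableZl mD k fi). Qed.

Let integrableD_EFin (f g : T -> R) :
  mu.-integrable D (EFin \o f) -> mu.-integrable D (EFin \o g) ->
  mu.-integrable D (EFin \o (fun x => f x + g x)).
Proof. by move=> fi gi; apply: eq_integrable (integrableD mD fi gi). Qed.

Let integrableB_EFin (f g : T -> R) :
  mu.-integrable D (EFin \o f) -> mu.-integrable D (EFin \o g) ->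
  mu.-integrable D (EFin \o (fun x => f x - g x)).
Proof. by move=> fi gi; apply: eq_integrable (integrableB mD fi gi). Qed.

Let near0_neq0 (P : R -> Prop) : (\forall h \near (0 : R), P h) ->
  exists2 h, h != 0 & P h.
Proof.
move=> /nbhs_ballP[eps /= eps0 Pe]; exists (eps / 2); first by rewrite gt_eqF// divr_gt0.
by apply: Pe; rewrite /ball /= sub0r normrN gtr0_norm ?divr_gt0// gtr_pMr// invf_lt1// ltr1n.
Qed.

(** One nonzero step [h] suffices, as the squared score is dominated by the two
densities and the squared remainder. *)
Lemma score_sqr_integrable :
  mu.-integrable D (EFin \o (fun x => s x ^+ 2 * p0 x)).
Proof.
have [h h0 [Th ri _]] := near0_neq0 (remainder_small ltr01).
have pi := density_integrable Th; have p0i := density_integrable Theta0.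
have ph_ge0 x : D x -> 0 <= p (theta0 + h) x by have [_ + _] := dens Th; apply.
pose k := 8 / h ^+ 2.
have h2 : 0 < h ^+ 2 by rewrite lt0r sqrf_eq0 h0 sqr_ge0.
apply: (@le_integrable _ _ _ mu D mD _ (EFin \o
    (fun x => k * (p (theta0 + h) x + p0 x + rem h x ^+ 2)))).
- by apply/measurable_EFinP/measurable_funM => //; exact: measurable_funX.
- move=> x Dx /=; rewrite lee_fin ger0_norm; last first.
    by rewrite mulr_ge0 ?sqr_ge0// p0_ge0.
  apply: le_trans (ler_norm _).
  have := score_sqr_le (s x) h (sqrtr_ge0 (p0 x)) (sqrtr_ge0 (p (theta0 + h) x)).
  rewrite !sqr_sqrtr ?p0_ge0 ?ph_ge0// -/(rem h x) => H.
  have hk : h ^+ 2 * k = 8 by rewrite /k; field.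
  by rewrite -(ler_pM2l h2) [leRHS]mulrA hk.
- by apply: integrableZ_EFin; apply: integrableD_EFin => //; exact: integrableD_EFin.
Qed.

(** The bound [|s| <= s^2 + 1] reduces this to the squared score. *)
Lemma score_integrable : mu.-integrable D (EFin \o (fun x => s x * p0 x)).
Proof.
have p0i := density_integrable Theta0.
apply: (@le_integrable _ _ _ mu D mD _ 
  (EFin \o (fun x => s x ^+ 2 * p0 x + p0 x))).
- by apply/measurable_EFinP/measurable_funM.
- move=> x Dx /=; rewrite lee_fin normrM (ger0_norm (p0_ge0 Dx)).
  apply: le_trans (ler_norm _); rewrite -[X in _ + X]mul1r -mulrDl ler_wpM2r ?p0_ge0//.
  rewrite -real_normK ?num_real//; have := sqr_ge0 (`|s x| - 2^-1); lra.
- by apply: integrableD_EFin => //; exact: score_sqr_integrable.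
Qed.

(** The expansion of the root densities is multiplied by their sum; the cross term
[2 u z] is handled by the weighted inequality of [density_increment_le] instead
of the Cauchy-Schwarz inequality. *)
Lemma density_increment_small (eps : R) : 0 < eps -> \forall h \near (0 : R),
  Theta (theta0 + h) /\
  \int[mu]_(x in D) `|p (theta0 + h) x - p0 x - h * (s x * p0 x)| <=
    eps * `|h|.
Proof.
move=> eps0; pose S := \int[mu]_(x in D) (s x ^+ 2 * p0 x).
have S0 : 0 <= S.
  by apply: Rintegral_ge0 => x Dx; rewrite mulr_ge0 ?sqr_ge0// p0_ge0.
(* the bound obtained below is at most [q * (4 + S) * |h|] for [|h| < q] and a
   remainder of squared norm at most [q^2 h^2] *)
pose q := Num.min 1 (eps / (4 + S)).
have S4 : 0 < 4 + S by lra.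
have q0 : 0 < q by rewrite lt_min ltr01 divr_gt0.
have q1 : q <= 1 by rewrite ge_min lexx.
have qS : q * (4 + S) <= eps by rewrite -ler_pdivlMr// ge_min lexx orbT.
have hq : \forall h \near (0 : R), `|h| < q.
  by apply/nbhs_ballP; exists q => //= h; rewrite /ball /= sub0r normrN.
have q2 : 0 < q ^+ 2 by rewrite exprn_gt0.
apply: filterS2 hq (remainder_small q2) => h {}hq [Th ri rle]; split=> //.
have ph_ge0 x : D x -> 0 <= p (theta0 + h) x by have [_ + _] := dens Th; apply.
have [h0|h0] := eqVneq h 0.
  rewrite (@eq_Rintegral _ _ _ _ _ (cst 0)); last first.
    by move=> x _ /=; rewrite h0 addr0 subrr mul0r subr0 normr0.
  by rewrite Rintegral_cst// mul0r h0 normr0 mulr0.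
have ah0 : 0 < `|h| by rewrite normr_gt0.
pose k := q * `|h|; have k0 : 0 < k by rewrite mulr_gt0.
have pi := density_integrable Th; have p0i := density_integrable Theta0.
have si := score_integrable; have s2i := score_sqr_integrable.
apply: (@le_trans _ _ (\int[mu]_(x in D) (k * p0 x +
    (k^-1 + 2) * rem h x ^+ 2 + 2^-1 * h ^+ 2 * (s x ^+ 2 * p0 x)))).
  apply: le_Rintegral => //.
  - have := integrable_abse (integrableB_EFin (integrableB_EFin pi p0i) (integrableZ_EFin h si)).
    by apply: eq_integrable.
  - by apply: integrableD_EFin; [apply: integrableD_EFin|]; exact: integrableZ_EFin.
  move=> x Dx.
  have := density_increment_le (Num.sqrt (p0 x)) (Num.sqrt (p (theta0 + h) x))
    (s x) h k0.
  by rewrite !sqr_sqrtr ?p0_ge0 ?ph_ge0.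
rewrite RintegralD//; [|by apply: integrableD_EFin; exact: integrableZ_EFin|exact: integrableZ_EFin].
rewrite RintegralD//; [|exact: integrableZ_EFin|exact: integrableZ_EFin].
rewrite !RintegralZl// (Rintegral_density Theta0) -/S mulr1.
move: rle; set I := \int[mu]_(x in D) _ => rle.
have h2 : h ^+ 2 = `|h| ^+ 2 by rewrite real_normK// num_real.
have kI : (k^-1 + 2) * I <= 3 * k.
  apply: (@le_trans _ _ ((k^-1 + 2) * k ^+ 2)).
    rewrite ler_wpM2l ?addr_ge0 ?invr_ge0 ?(ltW k0)//.
    by rewrite /k exprMn -h2.
  rewrite mulrDl expr2 mulKf ?gt_eqF// -expr2.
  have : k <= 1 by rewrite /k mulr_ile1// ltW// (lt_le_trans hq).
  nra.
have hS : 2^-1 * h ^+ 2 * S <= k * S.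
  rewrite ler_wpM2r// h2 /k expr2; nra.
have : k * (4 + S) <= eps * `|h|.
  by rewrite /k mulrAC ler_wpM2r.
lra.
Qed.

(** Densities have the same integral, so that the L^1 derivative of [p] has
integral zero. *)
Lemma score_mean0 : \int[mu]_(x in D) (s x * p0 x) = 0.
Proof.
have p0i := density_integrable Theta0; have si := score_integrable.
set I := \int[mu]_(x in D) _; apply/eqP; rewrite -normr_le0.
apply/ler_addgt0Pl => eps eps0; rewrite addr0.
have [h h0 [Th hle]] := near0_neq0 (density_increment_small eps0).
have pi := density_integrable Th.
have ah0 : 0 < `|h| by rewrite normr_gt0.
rewrite -(ler_pM2r ah0); apply: le_trans hle.
have hsi := integrableZ_EFin h si; have ppi := integrableB_EFin pi p0i.
have ppsi := integrableB_EFin ppi hsi.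
apply: le_trans (le_normr_Rintegral mD ppsi).
rewrite !RintegralB// !Rintegral_density// subrr sub0r normrN RintegralZl//.
by rewrite normrM mulrC.
Qed.

End quadratic_mean.

(** * The privatized two-point model *)

Section privatized_model.
Context {R : realType} {d : nat} {X : set 'rV[R]_d}.
Context {oX : open X} {alpha : {posnum R}}.
Local Notation B := (Bspace oX alpha).
Local Notation E := (Espace oX alpha).
Local Notation leb := (lebesgue_rV d).
Local Notation a := (expR alpha%:num).
Context {Theta : set R} {p : R -> 'rV[R]_d -> R} {theta0 : R}.
Context {s : 'rV[R]_d -> R} {e : 'rV[R]_d -> B -> R}.
Hypothesis ee : evaluation_operator e.
Hypothesis dens : density_model leb X Theta p.
Hypothesis intTheta : interior Theta theta0.
Hypothesis dqms : dqm leb X p theta0 s.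
Local Notation p0 := (p theta0).

Let mX : measurable X := rV_open_measurable oX.

Let Theta0 : Theta theta0. Proof. exact: nbhs_singleton intTheta. Qed.

Let p_ge0 theta : Theta theta -> forall x, X x -> 0 <= p theta x.
Proof. by move=> /dens[]. Qed.

Let p_int theta : Theta theta -> leb.-integrable X (EFin \o p theta).
Proof. by move=> Th; exact: (density_integrable dens Th). Qed.

Let p_1 theta : Theta theta -> \int[leb]_(x in X) p theta x = 1.
Proof. by move=> Th; exact: (Rintegral_density dens Th). Qed.

Let sp_int := score_integrable mX dens intTheta dqms.

Let mass_ge1 theta (z : B) : Theta theta -> 1 <= mass (p theta) z.
Proof.
move=> Th.
by have /andP[] := mass_bounds (p_ge0 Th) (p_int Th) (p_1 Th) z.
Qed.

(** Testing against the bounded class [z] preserves differentiability in L^1. *)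
Lemma mass_increment_small (z : B) (eps : R) : 0 < eps ->
  \forall h \near (0 : R), Theta (theta0 + h) /\
  `|mass (p (theta0 + h)) z - mass p0 z - h * drift s p0 z| <= eps * `|h|.
Proof.
move=> eps0; have a0 : 0 < a by exact: expR_gt0.
have ea0 : 0 < eps / a by rewrite divr_gt0.
have := density_increment_small mX dens intTheta dqms ea0.
apply: filterS => h [Th hle]; split=> //.
have ppi : leb.-integrable X (EFin \o (fun x => p (theta0 + h) x - p0 x)).
  by apply: eq_integrable (integrableB mX (p_int Th) (p_int Theta0)).
have hsi : leb.-integrable X (EFin \o (fun x => h * (s x * p0 x))).
  by apply: eq_integrable (integrableZl mX h sp_int).
pose f x := p (theta0 + h) x - p0 x - h * (s x * p0 x).
have fi : leb.-integrable X (EFin \o f).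
  by apply: eq_integrable (integrableB mX ppi hsi).
have -> : mass (p (theta0 + h)) z - mass p0 z - h * drift s p0 z =
    \int[leb]_(x in X) (f x * z x).
  have i1 := integrable_mulB z (p_int Th).
  have i2 := integrable_mulB z (p_int Theta0).
  have i3 := integrable_mulB z sp_int.
  have hi3 : leb.-integrable X (EFin \o (fun x => h * (s x * p0 x * z x))).
    by apply: eq_integrable (integrableZl mX h i3).
  have i12 : leb.-integrable X
      (EFin \o (fun x => p (theta0 + h) x * z x - p0 x * z x)).
    by apply: eq_integrable (integrableB mX i1 i2).
  rewrite /mass /drift -RintegralZl// -!RintegralB//.
  by apply: eq_Rintegral => x _; rewrite /f; ring.
rewrite Rintegral_clip//.
apply: le_trans (le_normr_Rintegral mX (integrable_clip z fi)) _.
have afi : leb.-integrable X (EFin \o (fun x => `|f x|)).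
  by have := integrable_abse fi; apply: eq_integrable.
apply: (@le_trans _ _ (a * \int[leb]_(x in X) `|f x|)); last first.
  apply: le_trans (ler_wpM2l (ltW a0) hle) _.
  by rewrite le_eqVlt; apply/orP; left; apply/eqP; field; rewrite gt_eqF.
rewrite -RintegralZl//; apply: le_Rintegral => //.
- by have := integrable_abse (integrable_clip z fi); apply: eq_integrable.
- by apply: eq_integrable (integrableZl mX a afi).
- move=> x Xx; have /andP[z1 za] := clip_bounds z x.
  by rewrite normrM mulrC ler_wpM2r// ger0_norm//; exact: le_trans z1.
Qed.

(** At a fixed point [z], the square root of [mass (p theta) z] is differentiable
in theta because the mass is, and is at least 1. *)
Lemma mass_dqm (z : B) (eps : R) : 0 < eps -> \forall h \near (0 : R),
  Theta (theta0 + h) /\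
  (Num.sqrt (mass (p (theta0 + h)) z) - Num.sqrt (mass p0 z)
    - 2^-1 * h * (drift s p0 z / mass p0 z) * Num.sqrt (mass p0 z)) ^+ 2
  <= eps * h ^+ 2.
Proof.
move=> eps0; pose k := Num.min 1 eps.
have k0 : 0 < k by rewrite lt_min ltr01.
have k1 : k <= 1 by rewrite ge_min lexx.
have keps : k <= eps by rewrite ge_min lexx orbT.
set D := drift s p0 z.
(* the range of [h] on which [sqrt_increment_le] applies *)
pose q := k / (1 + `|D|) ^+ 2.
have D1 : 0 < (1 + `|D|) ^+ 2 by rewrite exprn_gt0// ltr_wpDr.
have q0 : 0 < q by rewrite divr_gt0.
have hq : \forall h \near (0 : R), `|h| < q.
  by apply/nbhs_ballP; exists q => //= h; rewrite /ball /= sub0r normrN.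
apply: filterS2 hq (mass_increment_small z k0) => h {}hq [Th hle].
split=> //.
have m1 := mass_ge1 z Th; have m01 := mass_ge1 z Theta0.
set x := Num.sqrt (mass (p (theta0 + h)) z); set y := Num.sqrt (mass p0 z).
have x1 : 1 <= x by rewrite -sqrtr1 ler_wsqrtr.
have y1 : 1 <= y by rewrite -sqrtr1 ler_wsqrtr.
have xE : x ^+ 2 = mass (p (theta0 + h)) z by rewrite sqr_sqrtr// (le_trans ler01).
have yE : y ^+ 2 = mass p0 z by rewrite sqr_sqrtr// (le_trans ler01).
have k01 : 0 < k <= 1 by rewrite k0.
have hD : `|h| * (1 + `|D|) ^+ 2 <= k by rewrite -ler_pdivlMr// ltW.
have := sqrt_increment_le x1 y1 k01 hD; rewrite xE yE => /(_ hle).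
have -> : 2^-1 * h * (D / y) = 2^-1 * h * (D / mass p0 z) * y.
  by rewrite -yE; field; rewrite gt_eqF// (lt_le_trans ltr01).
move=> H; rewrite -real_normK ?num_real//.
apply: (@le_trans _ _ ((k * `|h|) ^+ 2)).
  by rewrite ler_pXn2r// nnegrE// mulr_ge0// ltW.
rewrite exprMn real_normK ?num_real// ler_wpM2r ?sqr_ge0//.
by apply: le_trans keps; rewrite expr2 ler_piMl// ltW.
Qed.

(** The two-point measure itself dominates the privatized laws, with density
[mass (p theta)], and integrals against it have two terms, so that [mass_dqm] at
both atoms is enough. *)
Lemma two_point_fisher_information (r : E) :
  fisher_information_is Theta (privatized (mechanism e (two_point r)) p) theta0
    (info_integral s p0 (two_point r)).
Proof.
have c0 : 0 < 1 + a by rewrite ltr_wpDr// expR_ge0.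
have mmass theta : Theta theta ->
    measurable_fun setT (fun z : E => mass (p theta) z).
  by move=> Th; apply: measurable_Rintegral; exact: p_int.
have mdrift : measurable_fun setT (fun z : E => drift s p0 z).
  by apply: measurable_Rintegral; exact: sp_int.
have mscore : measurable_fun setT (fun z : E => drift s p0 z / mass p0 z).
  have -> : (fun z : E => drift s p0 z / mass p0 z) =
      (fun z : E => drift s p0 z * mass p0 z `^ (- 1)).
    apply/funext => z; rewrite powR_inv1//.
    exact: (le_trans ler01 (mass_ge1 (Espace_val z) Theta0)).
  apply: measurable_funM => //.
  by apply: (measurableT_comp (measurable_powR (- 1))); exact: mmass.
exists (two_point_subprob r), (fun theta (z : E) => mass (p theta) z),
  (fun z : E => drift s p0 z / mass p0 z); split.
- move=> theta Th; split; first exact: mmass.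
    by move=> z _; exact: (le_trans ler01 (mass_ge1 (Espace_val z) Th)).
  transitivity (\int[two_point r]_z (mass (p theta) (Espace_val z))%:E)%E => //.
  rewrite integral_two_point//; last exact: mmass.
  rewrite !in_setT !mul1r (mass_TB (p_int Th) (p_1 Th) (Espace_val r)).
  by congr EFin; field; rewrite gt_eqF.
- move=> theta A Th mA.
  transitivity (\int[two_point r]_(z in A) (mass (p theta) (Espace_val z))%:E)%E => //.
  rewrite integral_two_point//; last exact: measurable_funTS (mmass _ Th).
  set k := (1 + a)^-1; set u := (r \in A)%:R; set v := (TE r \in A)%:R.
  have i1 := integrable_mulB r (p_int Th).
  have i2 := integrable_mulB (TE r) (p_int Th).
  have ui1 : leb.-integrable X (EFin \o (fun x => u * (p theta x * r x))).
    by apply: eq_integrable (integrableZl mX u i1).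
  have vi2 : leb.-integrable X (EFin \o (fun x => v * (p theta x * (TE r) x))).
    by apply: eq_integrable (integrableZl mX v i2).
  have uvi : leb.-integrable X
      (EFin \o (fun x => u * (p theta x * r x) + v * (p theta x * (TE r) x))).
    by apply: eq_integrable (integrableD mX ui1 vi2).
  have fi : leb.-integrable X
      (EFin \o (fun x => k * (u * (p theta x * r x) + v * (p theta x * (TE r) x)))).
    by apply: eq_integrable (integrableZl mX k uvi).
  transitivity (\int[leb]_(x in X)
      (k * (u * (p theta x * r x) + v * (p theta x * (TE r) x)))%:E)%E.
    apply: ae_eq_integral => //.
    + apply: (@eq_measurable_fun _ _ _ _ X (fun x =>
          (k * (u * e x r + v * e x (TE r)) * p theta x)%:E)).
        move=> x /[!inE] Xx.
        rewrite /mechanism integral_two_point//.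
        exact: measurable_funTS (measurable_eval_l ee Xx).
      apply/measurable_EFinP; apply: measurable_funM; last by have [] := dens Th.
      apply: measurable_funM; first exact: measurable_cst.
      by apply: measurable_funD; apply: measurable_funM;
        try exact: measurable_cst; exact: measurable_eval_r.
    + exact: measurable_int fi.
    + apply: filterS (mechanism_two_point r ee) => x mxE Xx.
      rewrite mxE// -EFinM; congr EFin; rewrite -/k -/u -/v; ring.
  rewrite -[LHS]fineK; last exact: (integrable_fin_num mX fi).
  congr EFin; rewrite -[LHS]/(\int[leb]_(x in X) (k * (u * (p theta x * r x) +
    v * (p theta x * (TE r) x)))).
  by rewrite RintegralZl// RintegralD// !RintegralZl.
- split=> // eps eps0.
  have [near_r near_Tr] := (mass_dqm r eps0, mass_dqm (TE r) eps0).
  apply: filterS2 near_r near_Tr => h [Th hr] [_ hTr].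
  pose f (z : E) := (Num.sqrt (mass (p (theta0 + h)) z) - Num.sqrt (mass p0 z)
    - 2^-1 * h * (drift s p0 z / mass p0 z) * Num.sqrt (mass p0 z)) ^+ 2.
  have msqrt theta : Theta theta ->
      measurable_fun setT (fun z : E => Num.sqrt (mass (p theta) z)).
    move=> Tht; apply: (measurableT_comp _ (mmass _ Tht)).
    by apply: continuous_measurable_fun; exact: sqrt_continuous.
  have mf : measurable_fun setT f.
    apply: measurable_funX; apply: measurable_funB.
      by apply: measurable_funB; exact: msqrt.
    apply: measurable_funM; last exact: msqrt.
    by apply: measurable_funM => //; exact: measurable_cst.
  rewrite [leLHS](_ : _ = (\int[two_point r]_z (f z)%:E)%E)//.
  rewrite integral_two_point// !in_setT !mul1r lee_fin.
  rewrite -(ler_pM2l c0) mulrA divff ?gt_eqF// mul1r.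
  have a1 := expR_alpha_ge1 alpha.
  have eh : 0 <= eps * h ^+ 2 by rewrite mulr_ge0 ?sqr_ge0// ltW.
  apply: le_trans (lerD hr hTr) _; nra.
- rewrite /info_integral; apply: eq_integral => z _; congr EFin.
  rewrite infoE; field.
  by rewrite gt_eqF// (lt_le_trans ltr01)// mass_ge1.
Qed.

End privatized_model.

(** * The theorem *)

Theorem mainTheorem5 (R : realType) (d : nat) (X : set 'rV[R]_d)
    (oX : open X) (alpha : {posnum R})
    (e : 'rV[R]_d -> Bspace oX alpha -> R)
    (Theta : set R) (p : R -> 'rV[R]_d -> R) (theta0 : R)
    (s : 'rV[R]_d -> R) :
  evaluation_operator e ->
  density_model (lebesgue_rV d) X Theta p ->
  interior Theta theta0 ->
  dqm (lebesgue_rV d) X p theta0 s ->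
  (exists mubar : subprobability (Espace oX alpha) R,
    [/\ feasible e mubar,
        info_integral s (p theta0) mubar = Jmax e s (p theta0) &
        symmetric_measure mubar]) ->
  (exists rbar : Espace oX alpha, forall r : Bspace oX alpha,
    info_sym s (p theta0) r <= info_sym s (p theta0) rbar) /\
  (forall rbar : Espace oX alpha,
    (forall r : Bspace oX alpha,
      info_sym s (p theta0) r <= info_sym s (p theta0) rbar) ->
    [/\ symmetric_measure (two_point rbar),
        normalized e (two_point rbar),
        fisher_information_is Theta
          (privatized (mechanism e (two_point rbar)) p) theta0
          (info_integral s (p theta0) (two_point rbar)),
        info_integral s (p theta0) (two_point rbar) =
          (2 / (expR alpha%:num + 1) * info_sym s (p theta0) rbar)%:E &
        (2 / (expR alpha%:num + 1) * info_sym s (p theta0) rbar)%:E =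
          Jmax e s (p theta0)]).
Proof.
move=> ee dens intTheta dqms [mubar [[_ nmu] muJ smu]].
have mX : measurable X := rV_open_measurable oX.
have Theta0 : Theta theta0 by exact: nbhs_singleton intTheta.
have p0_ge0 : forall x, X x -> 0 <= p theta0 x by have [] := dens _ Theta0.
have p0_int := density_integrable dens Theta0.
have p0_1 := Rintegral_density dens Theta0.
have sp_int := score_integrable mX dens intTheta dqms.
have sp_0 := score_mean0 mX dens intTheta dqms.
have [r0 [r0J r0E]] := symmetric_optimum p0_ge0 p0_int p0_1 sp_int ee nmu muJ smu.
have r0B (r : Bspace oX alpha) :
    info_sym s (p theta0) r <= info_sym s (p theta0) r0.
  have [t rt] := info_sym_thresholded p0_ge0 p0_int p0_1 sp_int sp_0 r.
  exact: le_trans (r0E t).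
split; first by exists r0.
move=> rbar rbarB; split.
- exact: two_point_symmetric.
- exact: two_point_normalized.
- exact: two_point_fisher_information.
- exact: info_integral_two_point.
- rewrite -r0J; congr (_ * _)%:E; apply/eqP.
  by rewrite eq_le rbarB r0B.
Qed.
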